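(* Let $W$ be a complete discrete valuation ring with finite residue field of cardinality $q$, let $d\ge1$, and let $(A,B)$ be a random pair of monic polynomials of degree $d$ over $W$ distributed according to the Haar probability measure. For $j\in\{0,\dots,d-1\}$ let $V_j$ be the valuation of the $j$-th principal subresultant of $(A,B)$, $W_j$ the minimum of the valuations of the coefficients of the $j$-th subresultant $\mathrm{Res}_j(A,B)$, and $\delta_j=V_j-W_j$. Then for all $j\in\{0,\dots,d-1\}$ and all $m\in\mathbb N$, $$\mathbb P[\delta_j\ge m]\ge \frac{(q-1)(q^j-1)}{q^{j+1}-1}\,q^{-m}.$$
   Context: The set of pairs of monic degree-$d$ polynomials over $W$ is identified with $W^{2d}$ via the non-leading coefficients, with the product Haar probability measure. The $j$-th subresultant $\mathrm{Res}_j(A,B)$ (computed in degree $(d,d)$) is the polynomial of degree $\le j$ whose coefficient of $X^k$ ($0\le k\le j$) is the determinant of the square matrix of size $2(d-j)$ whose columns are the coefficient vectors of $X^{d-j-1}A,\dots,A,X^{d-j-1}B,\dots,B$ restricted to the monomials $X^{2d-j-1},\dots,X^{j+1},X^k$; its coefficient of $X^j$ is the $j$-th principal subresultant. Valuations of $0$ are $+\infty$. *)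

(* Defs.v *)
From HB Require Import structures.
From mathcomp Require Import all_boot all_order all_algebra.
From mathcomp Require Import all_classical all_reals all_analysis.

Set Implicit Arguments.
Unset Strict Implicit.
Unset Printing Implicit Defensive.

Import Order.TTheory GRing.Theory Num.Theory.

Local Open Scope classical_set_scope.
Local Open Scope ring_scope.

(* [idealr_closed] includes properness, and every subset of [W] is classically
   of the form [I : {pred W}].                                               *)
Definition nonzero_prime_ideal (W : idomainType) (I : {pred W}) : Prop :=
  [/\ idealr_closed I, prime_idealr_closed I & exists2 x, x \in I & x != 0].

(* A discrete valuation ring is a principal ideal domain with exactly one
   nonzero prime ideal. The improper ideal, generated by [1], need not be
   covered by [dvr_principal].                                               *)
HB.mixin Record isDVR W of GRing.IntegralDomain W := {
  dvr_principal : forall I : {pred W}, idealr_closed I ->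
    exists a : W, forall x, x \in I <-> exists y, x = y * a;
  dvr_prime_ideal : exists I : {pred W}, nonzero_prime_ideal I;
  dvr_prime_ideal_unique : forall I J : {pred W},
    nonzero_prime_ideal I -> nonzero_prime_ideal J -> I =i J
}.

#[short(type="dvrType")]
HB.structure Definition DVR := {W of GRing.IntegralDomain W & isDVR W}.

Section dvr.
Variable W : dvrType.

Definition maxideal : W -> bool := sval (cid (@dvr_prime_ideal W)).

Lemma maxidealP : nonzero_prime_ideal maxideal.
Proof. exact: svalP (cid (@dvr_prime_ideal W)). Qed.

Lemma maxideal_idealr_closed : idealr_closed maxideal.
Proof. by case: maxidealP. Qed.

HB.instance Definition _ := isIdealr.Build W maxideal maxideal_idealr_closed.

Definition residue_field : comNzRingType := {ideal_quot (maxideal : idealr W)}.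

(* The ideal generated by the [n]-fold products of elements of [maxideal];
   the coefficients [c] are needed for [n = 0].                              *)
Definition maxideal_pow (n : nat) : set W :=
  [set x | exists (k : nat) (c : 'I_k -> W) (f : 'I_k -> 'I_n -> W),
     (forall i l, f i l \in maxideal) /\
     x = \sum_(i < k) c i * \prod_(l < n) f i l].

Definition adic_open : set (set W) :=
  [set U | forall x, U x -> exists n, forall y, maxideal_pow n (y - x) -> U y].

Definition adic_cauchy (u : nat -> W) : Prop :=
  forall n, exists N, forall i j, (N <= i)%N -> (N <= j)%N ->
    maxideal_pow n (u i - u j).

Definition adic_cvg (u : nat -> W) (l : W) : Prop :=
  forall n, exists N, forall i, (N <= i)%N -> maxideal_pow n (u i - l).

Definition adic_complete : Prop :=
  forall u, adic_cauchy u -> exists l, adic_cvg u l.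

(* The normalised valuation; it is [+oo] at [0]. *)
Definition valuation (R : realType) (x : W) : \bar R :=
  ereal_sup [set (n%:R)%:E | n in [set n : nat | maxideal_pow n x]].

End dvr.

Arguments residue_field : clear implicits.
Arguments adic_complete : clear implicits.
Arguments valuation {W} R x.

Definition pointed_dvr (W : dvrType) : Type := W.
HB.instance Definition _ (W : dvrType) := Choice.on (pointed_dvr W).
HB.instance Definition _ (W : dvrType) :=
  isPointed.Build (pointed_dvr W) (0 : W).

(* [W] with the Borel sigma-algebra of its adic topology *)
Definition borel_dvr (W : dvrType) :=
  g_sigma_algebraType (@adic_open W : set (set (pointed_dvr W))).
HB.instance Definition _ (W : dvrType) := Measurable.on (borel_dvr W).

Definition is_haar (W : dvrType) (R : realType)
    (mu : probability (borel_dvr W) R) : Prop :=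
  forall (x : W) (E : set (borel_dvr W)), measurable E ->
    mu [set (x + (y : W) : W) | y in E] = mu E.

Section power_probability.
Context d (T : measurableType d) (R : realType).

Definition tuple_cons n (x : T * n.-tuple T) : n.+1.-tuple T :=
  [tuple of x.1 :: x.2].

Lemma measurable_tuple_cons n : measurable_fun [set: T * n.-tuple T]
  (@tuple_cons n).
Proof. exact: measurable_cons. Qed.

HB.instance Definition _ n := isMeasurableFun.Build _ _ _ _ (@tuple_cons n)
  (@measurable_tuple_cons n).

(* the [n]-fold product of [mu] *)
Fixpoint power_probability (mu : probability T R) (n : nat) :
    probability (n.-tuple T) R :=
  match n with
  | 0 => dirac ([tuple] : 0.-tuple T)
  | n'.+1 => distribution (mu \x power_probability mu n')%E (@tuple_cons n')
  end.

End power_probability.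

(* The monic polynomial of degree [d] whose coefficient of ['X^i] is the
   [i]-th entry of [t], for [i < d].                                         *)
Definition monic_of (W : nzRingType) (d : nat) (t : d.-tuple W) : {poly W} :=
  'X^d + Poly t.

Section subresultant.
Variables (W : comNzRingType) (d j : nat) (A B : {poly W}).

(* The columns are ['X^(d-j-1) A, ..., A, 'X^(d-j-1) B, ..., B] and the rows
   are indexed by ['X^(2d-j-1), ..., 'X^(j+1), 'X^k].                        *)
Definition subresultant_mx (k : nat) : 'M[W]_(2 * (d - j)) :=
  \matrix_(r, c)
    (if (c < d - j)%N then 'X^((d - j).-1 - c) * A
     else 'X^((2 * (d - j)).-1 - c) * B)
    `_(if (r < (2 * (d - j)).-1)%N then (2 * d - j).-1 - r else k)%N.

Definition subresultant : {poly W} :=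
  \poly_(k < j.+1) \det (subresultant_mx k).

Definition principal_subresultant : W := subresultant`_j.

End subresultant.

Section valuations.
Variables (W : dvrType) (R : realType) (d j : nat).
Variables (A B : {poly W}).
Local Open Scope ereal_scope.

Definition subresultant_V : \bar R := valuation R (principal_subresultant d j A B).

Definition subresultant_W : \bar R :=
  \big[mine/+oo]_(k < j.+1) valuation R (subresultant d j A B)`_k.

(* Here [+oo - +oo = -oo], so a pair with [subresultant d j A B = 0] is not
   counted in the event [m <= subresultant_delta].                                       *)
Definition subresultant_delta : \bar R := subresultant_V - subresultant_W.

End valuations.

Arguments subresultant_delta {W} R d j A B.

(* Main.v *)
Require Import Defs.
From HB Require Import structures.
From mathcomp Require Import all_boot all_order all_algebra.
From mathcomp Require Import all_classical all_reals all_analysis.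
From mathcomp Require Import zify ring.

(* Put n = j + 1 and call (A, B) good when the Euclidean algorithm of (A, B)
   passes through degree n with unit leading coefficients: there are cofactors
   with T = U A + V B monic of degree n and S = U' A + V' B of degree < n. Then
   U V' - U' V = 1, and (A, B) |-> (A - C V, B + C U) keeps the cofactors and T
   while it turns S into S + C. Over a finite quotient of W this shows that S is
   equidistributed on the good pairs, and Res_j(A, B) is a unit times S, so that
   delta_j is read off S. Over the residue field the same translations, applied
   at the last degree before the algorithm skips n, show that at most one pair
   out of q is not good, and goodness lifts from the residue field since it says
   that the n-th principal subresultant is a unit. Summing over the possible
   minimal valuations w of S gives the geometric series
   (1 - 1/q) * sum_w (1 - q^-j) q^-m q^-(w (j + 1)). *)

Import Order.TTheory GRing.Theory Num.Theory.
Import numFieldNormedType.Exports.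

Local Open Scope classical_set_scope.
Local Open Scope ring_scope.

Set Implicit Arguments.
Unset Strict Implicit.
Unset Printing Implicit Defensive.

(** * Cofactors of the Euclidean algorithm *)

Section euclid.
Variables (R : comNzRingType) (d : nat).
Implicit Types (A B U V P Q C : {poly R}) (n : nat).

(* At [n = d] this holds with [U * A + V * B = A]; for this reason the sizes of
   [U] and [U'] are left free. *)
Definition euclid_at n A B U V U' V' : Prop :=
  [/\ (size V + n <= d)%N,
      V' \is monic /\ (size V' + n)%N = d.+1,
      U * A + V * B \is monic /\ size (U * A + V * B) = n.+1
    & (size (U' * A + V' * B)%R <= n)%N].

(* [size_polyN] leaves a term on another inheritance path of [R], which [lia]
   does not identify with the other sizes. *)
Lemma size_polyNE P : size (- P) = size P.
Proof. exact: size_polyN. Qed.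

Lemma size_subr_leq P Q k :
  (size P <= k -> size Q <= k -> size (P - Q)%R <= k)%N.
Proof.
by move=> sP sQ; rewrite (leq_trans (size_polyD _ _)) ?size_polyNE ?geq_max ?sP.
Qed.

(** Degrees add under multiplication by a monic polynomial over any commutative ring. Cofactors are
    bounded this way, through their products with [A], [T] or [V']. *)
Lemma size_monicM_leq P Q k : P \is monic ->
  (size (P * Q)%R < k + size P -> size Q <= k)%N.
Proof.
move=> mP; have [->|Q0] := eqVneq Q 0; first by rewrite size_poly0.
rewrite size_monicM //; move: (monic_neq0 mP); rewrite -size_poly_gt0; lia.
Qed.

Lemma size_monicMM P Q : P \is monic -> Q \is monic ->
  (size (P * Q)).+1 = (size P + size Q)%N.
Proof.
move=> mP mQ; rewrite size_monicM ?monic_neq0 // prednK //.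
by rewrite addn_gt0 size_poly_gt0 monic_neq0.
Qed.

Lemma monic_div P Q : Q \is monic ->
  exists q r : {poly R}, P = q * Q + r /\ (size r < size Q)%N.
Proof.
move=> mQ; exists (Pdiv.Ring.rdivp P Q), (Pdiv.Ring.rmodp P Q).
split; first exact: Pdiv.RingMonic.rdivp_eq.
by rewrite Pdiv.Ring.ltn_rmodpN0 // monic_neq0.
Qed.

Lemma euclid_at_le n A B U V U' V' : euclid_at n A B U V U' V' -> (n <= d)%N.
Proof. by case; lia. Qed.

(** Multiplied by [A], the determinant becomes [T * V' - S * V], which the size conditions make
    monic of degree [d]. As [A] is itself monic of degree [d], the determinant is the constant 1. *)
Lemma euclid_at_unimodular n A B U V U' V' :
  A \is monic -> size A = d.+1 -> euclid_at n A B U V U' V' ->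
  U * V' - U' * V = 1.
Proof.
move=> mA sA [sV [mV' sV'] [mT sT] sS].
set T := U * A + _ in mT sT; set S := U' * A + _ in sS.
have eq : A * (U * V' - U' * V) = T * V' - S * V by rewrite /T /S; ring.
have sSV : (size (S * V)%R <= d)%N.
  by have := size_polyMleq S V; lia.
have mTV : T * V' \is monic by rewrite monicMl.
have sTV : size (T * V') = d.+1 by rewrite size_monicM ?monic_neq0 // sT; lia.
have sE : size (T * V' - S * V) = d.+1.
  by rewrite size_polyDl // size_polyNE sTV ltnS.
have mE : T * V' - S * V \is monic.
  by rewrite monicE lead_coefDl ?size_polyNE ?sTV ?ltnS // -monicE.
set w := _ - _ in eq *; rewrite -eq in sE mE.
have sw : (size w <= 1)%N by apply: (size_monicM_leq mA); rewrite sE sA.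
move: mE; rewrite monicE lead_coef_monicM // => /eqP.
by rewrite (size1_polyC sw) lead_coefC => ->.
Qed.

(* Cramer's rule writes [(P, Q)] as [a (U, V) + b (U', V')]; degrees force
   first [b = 0], then [a = 0]. *)
Lemma euclid_at_eq0 n A B U V U' V' P Q :
  A \is monic -> size A = d.+1 -> euclid_at n A B U V U' V' ->
  (size Q + n <= d)%N -> (size (P * A + Q * B)%R <= n)%N -> P = 0 /\ Q = 0.
Proof.
move=> mA sA E sQ sPQ; have w1 := euclid_at_unimodular mA sA E.
case: E => sV _ [mT sT] sS.
have b0 : U * Q - V * P = 0.
  have eq : A * (U * Q - V * P) = (U * A + V * B) * Q - (P * A + Q * B) * V.
    by ring.
  apply/eqP; rewrite -size_poly_eq0 -leqn0; apply: (size_monicM_leq mA).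
  rewrite eq sA ltnS; apply: size_subr_leq.
    have := size_polyMleq (U * A + V * B) Q; lia.
  have := size_polyMleq (P * A + Q * B) V; lia.
have eP : P = (P * V' - Q * U') * U.
  rewrite -[LHS]mulr1 -w1 -[RHS]addr0 -(mul0r U') -b0; ring.
have eQ : Q = (P * V' - Q * U') * V.
  rewrite -[LHS]mulr1 -w1 -[RHS]addr0 -(mul0r V') -b0; ring.
have a0 : P * V' - Q * U' = 0.
  apply/eqP; rewrite -size_poly_eq0 -leqn0; apply: (size_monicM_leq mT).
  by rewrite sT ltnS mulrC mulrDr !mulrA -eP -eQ.
by split; [rewrite eP | rewrite eQ]; rewrite a0 mul0r.
Qed.

Lemma size_monicB P Q k : P \is monic -> size P = k.+1 ->
  Q \is monic -> size Q = k.+1 -> (size (P - Q)%R <= k)%N.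
Proof.
move=> mP sP mQ sQ; apply/leq_sizeP => i; rewrite coefB.
rewrite leq_eqVlt => /predU1P[<-|ki]; last first.
  by rewrite !nth_default ?subrr ?sP ?sQ.
move/monicP: mP; move/monicP: mQ; rewrite /lead_coef sP sQ /= => -> ->.
by rewrite subrr.
Qed.

(** Differences of two systems of cofactors fall under [euclid_at_eq0]: the leading terms of the two
    [T] cancel, and so do those of the two [V']. *)
Lemma euclid_at_unique n A B U V U' V' P Q P' Q' :
  A \is monic -> size A = d.+1 ->
  euclid_at n A B U V U' V' -> euclid_at n A B P Q P' Q' ->
  [/\ P = U, Q = V, P' = U' & Q' = V'].
Proof.
move=> mA sA E E'; have Z := euclid_at_eq0 mA sA E.
case: E => sV [mV' sV'] [mT sT] sS; case: E' => sQ [mQ' sQ'] [mT' sT'] sS'.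
have [||P0 Q0] := Z (P - U) (Q - V).
- have : (size (Q - V)%R <= d - n)%N by apply: size_subr_leq; lia.
  lia.
- by rewrite !mulrBl addrACA -opprD; apply: size_monicB.
have [||P'0 Q'0] := Z (P' - U') (Q' - V').
- have : (size (Q' - V')%R <= d - n)%N by apply: size_monicB => //; lia.
  lia.
- by rewrite !mulrBl addrACA -opprD; apply: size_subr_leq.
by split; apply/eqP; rewrite -subr_eq0; apply/eqP.
Qed.

Lemma euclid_at_top A B : A \is monic -> size A = d.+1 ->
  B \is monic -> size B = d.+1 -> euclid_at d A B 1 0 (-1) 1.
Proof.
move=> mA sA mB sB; split.
- by rewrite size_poly0.
- by rewrite monic1 size_poly1.
- by rewrite mul1r mul0r addr0.
- by rewrite mulN1r mul1r addrC; apply: size_monicB.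
Qed.

(** Follows from [U * A = T - V * B], whose right side has degree at most [2 * d - n]. *)
Lemma euclid_at_sizeU n A B U V U' V' :
  A \is monic -> size A = d.+1 -> size B = d.+1 -> euclid_at n A B U V U' V' ->
  (size U + n <= d.+1)%N.
Proof.
move=> mA sA sB E; have nd := euclid_at_le E.
case: E => sV _ [mT sT] _.
suff : (size U <= (d - n).+1)%N by lia.
apply: (size_monicM_leq mA); rewrite mulrC -[U * A](addrK (V * B)) sA.
rewrite addSn ltnS.
apply: size_subr_leq; first by rewrite sT; lia.
by have := size_polyMleq V B; lia.
Qed.

(** The two corrections cancel in [T], while [S] gains [C * (U * V' - U' * V) = C]. The bound on [C]
    keeps [C * V] and [C * U] of degree less than [d], so the new pair is again monic of degree
    [d]. *)
Lemma euclid_at_translate n A B U V U' V' C :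
  A \is monic -> size A = d.+1 -> B \is monic -> size B = d.+1 ->
  euclid_at n A B U V U' V' -> (size C <= n)%N ->
  let A1 := A - C * V in let B1 := B + C * U in
  [/\ A1 \is monic /\ size A1 = d.+1, B1 \is monic /\ size B1 = d.+1,
      euclid_at n A1 B1 U V U' V'
    & U' * A1 + V' * B1 = U' * A + V' * B + C].
Proof.
move=> mA sA mB sB E sC A1 B1; have w1 := euclid_at_unimodular mA sA E.
have sU := euclid_at_sizeU mA sA sB E.
have nd := euclid_at_le E.
have sCV : (size (- (C * V))%R < size A)%N.
  case: (E) => sV _ _ _; rewrite size_polyNE.
  by have := size_polyMleq C V; lia.
have sCU : (size (C * U)%R < size B)%N.
  by have := size_polyMleq C U; lia.
have eT : U * A1 + V * B1 = U * A + V * B by rewrite /A1 /B1; ring.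
have eS : U' * A1 + V' * B1 = U' * A + V' * B + C.
  by rewrite -[in RHS](mulr1 C) -w1 /A1 /B1; ring.
split => //.
- by rewrite size_polyDl // monicE lead_coefDl // -monicE.
- by rewrite size_polyDl // monicE lead_coefDl // -monicE.
case: E => sV mV' mT sS; split => //; first by rewrite eT.
rewrite eS; apply: leq_trans (size_polyD _ _) _.
by rewrite geq_max sS.
Qed.

(* One step of Euclid's algorithm: divide [T] by the next remainder [S]. *)
Lemma euclid_at_step n i A B U V U' V' c :
  euclid_at n A B U V U' V' -> size (U' * A + V' * B) = i.+1 ->
  c * lead_coef (U' * A + V' * B) = 1 ->
  exists P Q P' Q', euclid_at i A B P Q P' Q'.
Proof.
case=> sV [mV' sV'] [mT sT]; set T := U * A + _ in mT sT.
set S := U' * A + _ => sS siS cS; set l := lead_coef S in cS.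
have regc : GRing.lreg c.
  by move=> x y /(congr1 ( *%R l)); rewrite !mulrA (mulrC l) cS !mul1r.
have mS : c *: S \is monic by rewrite monicE lead_coef_lreg // cS.
have scS : size (c *: S) = i.+1 by rewrite lreg_size.
have [q [r [eT sr']]] := monic_div T mS.
have sr : (size (- r)%R <= i)%N.
  by rewrite size_polyNE -ltnS -scS.
have eq : q * (c *: S) = T - r by rewrite eT addrK.
have ltr : (size (- r)%R < size T)%N by lia.
have sq' : size (q * (c *: S)) = n.+1 by rewrite eq size_polyDl.
have mq : q \is monic.
  by rewrite monicE -(lead_coef_Mmonic q mS) eq lead_coefDl // -monicE.
have sq : (size q + i = n.+1)%N.
  by have := size_monicMM mq mS; lia.
have sqV : size (q * V') = (d - i).+1.
  by have := size_monicMM mq mV'; lia.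
have slV : (size (- (l *: V))%R < size (q * V')%R)%N.
  by rewrite size_polyNE; have := size_scale_leq l V; lia.
(* Since [l * c = 1], the division gives [q * S - l *: T = l *: (- r)]. The factor [l] is what makes
   the new cofactor [q * V' - l *: V] monic. *)
exists (c *: U'), (c *: V'), (q * U' - l *: U), (q * V' - l *: V); split.
- by rewrite lreg_size //; lia.
- rewrite monicE lead_coefDl // -monicE monicMl // size_polyDl // sqV.
  by split=> //; lia.
- by rewrite -!scalerAl -scalerDr.
have -> : (q * U' - l *: U) * A + (q * V' - l *: V) * B = l *: (- r).
  have -> : - r = q * (c *: S) - T by rewrite eq; ring.
  rewrite scalerBr -scalerAr scalerA (mulrC l) cS scale1r -!mul_polyC /T /S.
  by ring.
by apply: leq_trans (size_scale_leq _ _) _.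
Qed.
End euclid.

(** * Subresultant determinants *)

Section sylvester.
Variables (R : comNzRingType).
Implicit Types (A B U V P Q C : {poly R}) (d j n k : nat).

Lemma sum_rev_coef_poly e P A : (size P <= e)%N ->
  \sum_(0 <= c < e) P`_(e.-1 - c) *: ('X^(e.-1 - c) * A) = P * A.
Proof.
move=> sP; rewrite big_mkord (reindex_inj rev_ord_inj) /=.
have eP : P = \poly_(i < e) P`_i.
  apply/polyP => i; rewrite coef_poly; case: ltnP => // ei.
  by rewrite nth_default // (leq_trans sP).
rewrite [in RHS]eP poly_def mulr_suml; apply: eq_bigr => i _.
have -> : (e.-1 - (e - i.+1))%N = i by have := ltn_ord i; lia.
by rewrite scalerAl.
Qed.

(** The exponent of the monomial attached to row [r] of [subresultant_mx]. For [k = j] the last row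
    continues the decreasing pattern. *)
Definition sylvester_row d j k r : nat :=
  if (r < (2 * (d - j)).-1)%N then ((2 * d - j).-1 - r)%N else k.

Definition cofactor_mx e (P Q : nat -> {poly R}) : 'M[R]_(2 * e) :=
  \matrix_(c, i) (if (c < e)%N then (P i)`_(e.-1 - c)
                  else (Q i)`_((2 * e).-1 - c)).

(** Right multiplication by a cofactor matrix replaces the shifts of [A] and [B] by chosen
    combinations of them. Determinants are then computed by choosing combinations that make the
    product triangular. *)
Lemma mul_subresultant_mx d j k A B (P Q : nat -> {poly R}) :
  (forall i, (i < 2 * (d - j))%N -> (size (P i) <= d - j)%N) ->
  (forall i, (i < 2 * (d - j))%N -> (size (Q i) <= d - j)%N) ->
  subresultant_mx d j A B k *m cofactor_mx (d - j) P Q =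
  \matrix_(r, i) (P i * A + Q i * B)`_(sylvester_row d j k r).
Proof.
move=> sP sQ; apply/matrixP => r i; rewrite !mxE.
under eq_bigr do rewrite !mxE.
set e := (d - j)%N in sP sQ *; rewrite -/(sylvester_row d j k r).
set x := sylvester_row _ _ _ _.
rewrite -(sum_rev_coef_poly A (sP i (ltn_ord i))).
rewrite -(sum_rev_coef_poly B (sQ i (ltn_ord i))).
rewrite coefD !coef_sum.
rewrite -(big_mkord xpredT (fun c => (if (c < e)%N then 'X^(e.-1 - c) * A
     else 'X^((2 * e).-1 - c) * B)`_x * (if (c < e)%N then (P i)`_(e.-1 - c)
                  else (Q i)`_((2 * e).-1 - c)))).
rewrite (big_cat_nat (n := e)) //=; last by lia.
congr (_ + _).
  by apply: eq_big_nat => c /andP[_ ->]; rewrite coefZ mulrC.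
rewrite -{1}[e]add0n big_addn (_ : (2 * e - e)%N = e); last by lia.
apply: eq_big_nat => c /andP[_ ce].
rewrite ltnNge leq_addl /= coefZ mulrC.
by have -> : ((2 * e).-1 - (c + e) = e.-1 - c)%N by lia.
Qed.

(** The combination is ['X^i * T - q * S], where [q] reduces the cofactor of [B] modulo [V']. The
    second bound yields size at most [d - n] for [PQ.1] as long as [n + i < 2 * d - n]. *)
Lemma euclid_at_cofactors d n A B U V U' V' i :
  A \is monic -> size A = d.+1 -> size B = d.+1 ->
  euclid_at d n A B U V U' V' -> exists PQ : {poly R} * {poly R},
  [/\ (size PQ.2 + n <= d)%N,
      (size PQ.1 + d <= maxn (n + i).+1 (2 * d - n))%N,
      PQ.1 * A + PQ.2 * B \is monic
    & size (PQ.1 * A + PQ.2 * B) = (n + i).+1].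
Proof.
move=> mA sA sB E; have nd := euclid_at_le E.
case: E => sV [mV' sV'] [mT sT] sS.
have [q [r [eq sr]]] := monic_div ('X^i * V) mV'.
have mX : 'X^i \is @monic R := monicXn _ _.
have sX : size ('X^i : {poly R}) = i.+1 := size_polyXn _ _.
have sq : (size q <= i)%N.
  apply: (@size_monicM_leq _ V' q i mV').
  rewrite mulrC -[q * V'](addrK r) -eq.
  apply: (@leq_ltn_trans (i + (d - n))%N); last by lia.
  apply: size_subr_leq; last by lia.
  by have := size_polyMleq 'X^i V; lia.
exists ('X^i * U - q * U', r) => /=.
have er : r = 'X^i * V - q * V' by rewrite eq addrC addKr.
have ev : ('X^i * U - q * U') * A + r * B =
    'X^i * (U * A + V * B) - q * (U' * A + V' * B) by rewrite er; ring.
have sqS : (size (- (q * (U' * A + V' * B)))%R <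
            size ('X^i * (U * A + V * B))%R)%N.
  rewrite size_polyNE; have := size_polyMleq q (U' * A + V' * B).
  by have := size_monicMM mX mT; lia.
have sv : size (('X^i * U - q * U') * A + r * B) = (n + i).+1.
  by rewrite ev size_polyDl //; have := size_monicMM mX mT; lia.
have srd : (size r + n <= d)%N by lia.
split => //.
- set m := maxn _ _; have dm : (d <= m)%N by rewrite /m; lia.
  rewrite -(subnK dm) leq_add2r.
  apply: (size_monicM_leq mA); rewrite mulrC sA.
  rewrite -[_ * A](addrK (r * B)).
  apply: (@leq_ltn_trans m); last by lia.
  apply: size_subr_leq; first by rewrite sv leq_maxl.
  by have := size_polyMleq r B; rewrite /m; lia.
- by rewrite ev monicE lead_coefDl // -monicE monicMl.
Qed.

Lemma det_trig1 m (M : 'M[R]_m) :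
  (forall r c : 'I_m, (r < c)%N -> M r c = 0) -> (forall r, M r r = 1) ->
  \det M = 1.
Proof.
move=> M0 M1; rewrite det_trig; first by rewrite big1.
by apply/is_trig_mxP => r c; apply: M0.
Qed.

(** With monic combinations of degrees [2 * d - n - 1] down to [n] as columns, the product is lower
    triangular with 1 on the diagonal. The determinant of the cofactors is therefore the inverse. *)
Lemma euclid_at_principal_subresultant d n A B U V U' V' :
  A \is monic -> size A = d.+1 -> size B = d.+1 ->
  euclid_at d n A B U V U' V' ->
  exists y, principal_subresultant d n A B * y = 1.
Proof.
move=> mA sA sB E; have nd := euclid_at_le E.
have [PQ PQP] := choice (fun i => euclid_at_cofactors i mA sA sB E).
set e := (d - n)%N.
(* The reversed index gives column [c] the degree [2 * d - n - 1 - c], which is the exponent of row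
   [c]. *)
pose P c := (PQ ((2 * e).-1 - c)%N).1; pose Q c := (PQ ((2 * e).-1 - c)%N).2.
exists (\det (cofactor_mx e P Q)).
rewrite /principal_subresultant /subresultant coef_poly ltnSn -det_mulmx.
rewrite mul_subresultant_mx.
- apply: det_trig1 => [r c rc|r]; rewrite !mxE /P /Q.
    have [_ _ _ sv] := PQP ((2 * e).-1 - c)%N.
    rewrite nth_default // sv /sylvester_row -/e.
    by have := ltn_ord r; have := ltn_ord c; rewrite /e; case: ifP; lia.
  have [_ _ /monicP mv sv] := PQP ((2 * e).-1 - r)%N.
  rewrite -[RHS]mv lead_coefE sv /=; congr (_`_ _).
  by rewrite /sylvester_row; have := ltn_ord r; rewrite /e; case: ifP; lia.
- by move=> i ie; have [_ + _ _] := PQP ((2 * e).-1 - i)%N; rewrite /P; lia.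
- by move=> i ie; have [+ _ _ _] := PQP ((2 * e).-1 - i)%N; rewrite /Q; lia.
Qed.

(** Monic combinations fill all columns but the last, which holds [S]. The product is lower
    triangular with diagonal 1, ..., 1 followed by the coefficient of ['X^k] in [S]. The cofactor
    matrix is the same for all [k], and its determinant is a unit. *)
Lemma euclid_at_subresultant d j A B U V U' V' :
  A \is monic -> size A = d.+1 -> size B = d.+1 ->
  euclid_at d j.+1 A B U V U' V' ->
  exists v y, v * y = 1 /\ subresultant d j A B = v *: (U' * A + V' * B).
Proof.
move=> mA sA sB E; have nd := euclid_at_le E.
have [PQ PQP] := choice (fun i => euclid_at_cofactors i mA sA sB E).
case: E => sV [mV' sV'] _ sS.
set e := (d - j)%N; pose l := (2 * e).-1.
pose P c := if (c < l)%N then (PQ (l.-1 - c)%N).1 else U'.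
pose Q c := if (c < l)%N then (PQ (l.-1 - c)%N).2 else V'.
have sU' : (size U' <= e)%N.
  apply: (size_monicM_leq mA); rewrite mulrC -[U' * A](addrK (V' * B)) sA.
  apply: (@leq_ltn_trans (e + d)%N); last by lia.
  apply: size_subr_leq; first by rewrite (leq_trans sS) // /e; lia.
  by have := size_polyMleq V' B; rewrite /e; lia.
have sP i : (i < 2 * e)%N -> (size (P i) <= d - j)%N.
  move=> ie; rewrite /P; case: ltnP => // il.
  by have [_ + _ _] := PQP (l.-1 - i)%N; rewrite /l /e; lia.
have sQ i : (i < 2 * e)%N -> (size (Q i) <= d - j)%N.
  move=> ie; rewrite /Q; case: ltnP => // il; last by lia.
  by have [+ _ _ _] := PQP (l.-1 - i)%N; rewrite /l /e; lia.
have vE (r c : 'I_(2 * e)) k : (r < l)%N -> (r <= c)%N ->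
    (P c * A + Q c * B)`_(sylvester_row d j k r) = (r == c)%:R.
  move=> rl rc; rewrite /P /Q /sylvester_row -/e -/l rl; case: ltnP => cl.
    have [<-|nrc] := eqVneq r c.
      have [_ _ /monicP mvr svr] := PQP (l.-1 - r)%N.
      rewrite -[RHS]mvr lead_coefE svr /=; congr (_`_ _).
      by move: rl; rewrite /l /e; lia.
    have [_ _ _ sv] := PQP (l.-1 - c)%N.
    rewrite nth_default // sv.
    have : (r < c)%N by rewrite ltn_neqAle rc andbT.
    by move: rl cl; rewrite /l /e; lia.
  rewrite nth_default; last first.
    by rewrite (leq_trans sS) //; move: rl; rewrite /l /e; lia.
  by have /negPf -> : r != c by apply: contraTneq cl => <-; lia.
(* [N] replaces the row depending on [k] by the one that extracts the coefficient of degree [e - 1]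
   of the second cofactor. In the last column this is the leading coefficient of [V'], so [N *m M]
   is lower triangular with 1 on the diagonal. *)
pose N : 'M[R]_(2 * e) := \matrix_(r, c)
  if (r < l)%N then subresultant_mx d j A B 0 r c else (c == e :> nat)%:R.
pose M := cofactor_mx e P Q.
have NM : \det N * \det M = 1.
  rewrite -det_mulmx.
  have NMl (r c : 'I_(2 * e)) : (r < l)%N ->
      (N *m M) r c = (P c * A + Q c * B)`_(sylvester_row d j 0 r).
    move=> rl; have /matrixP/(_ r c) := mul_subresultant_mx 0 A B sP sQ.
    rewrite mxE [X in _ = X -> _]mxE => <-; rewrite mxE; apply: eq_bigr => x _.
    by rewrite [N _ _]mxE rl.
  apply: det_trig1 => [r c rc|r].
    rewrite NMl ?vE ?(ltnW rc) //; last by have := ltn_ord c; rewrite /l; lia.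
      by rewrite -val_eqE ltn_eqF.
    by have := ltn_ord c; rewrite /l; lia.
  have [rl|rl] := ltnP r l; first by rewrite NMl // vE // eqxx.
  have e2 : (e < 2 * e)%N by rewrite /e; lia.
  rewrite mxE (bigD1 (Ordinal e2)) //= big1 ?addr0 => [|x xe].
    rewrite !mxE /= eqxx (ltnNge r) rl /= ltnn mul1r /Q (ltnNge r) rl /=.
    rewrite -[RHS](monicP mV') lead_coefE; congr (_`_ _).
    by move: sV'; rewrite /e; lia.
  rewrite mxE ltnNge rl /=.
  by rewrite -(inj_eq val_inj) /= in xe; rewrite (negPf xe) mul0r.
exists (\det N), (\det M); split=> //.
apply/polyP => k; rewrite coefZ coef_poly; case: ltnP => jk; last first.
  by rewrite nth_default ?mulr0 // (leq_trans sS).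
rewrite -[LHS]mulr1 -NM mulrCA mulrC [in RHS]mulrC; congr (_ * _).
rewrite -det_mulmx mul_subresultant_mx // det_trig; last first.
  apply/is_trig_mxP => r c rc; rewrite mxE vE ?(ltnW rc) //.
    by rewrite -val_eqE ltn_eqF.
  by have := ltn_ord c; rewrite /l /e; lia.
have l2 : (l < 2 * e)%N by rewrite /l /e; lia.
rewrite (bigD1 (Ordinal l2)) //= big1 ?mulr1 => [|r rl].
  by rewrite mxE /P /Q /sylvester_row /= -/e -/l ltnn.
rewrite mxE vE ?eqxx //.
rewrite -(inj_eq val_inj) /= in rl.
by have := ltn_ord r; move: rl; rewrite /l; lia.
Qed.

(** Cramer's rule: the adjugate scaled by [y] inverts the subresultant matrix, whose rows for
    [k = n] are exactly the degrees from [2 * d - n - 1] down to [n]. *)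
Lemma subresultant_solve d n A B y (t : nat -> R) : (n <= d)%N ->
  principal_subresultant d n A B * y = 1 -> exists P Q : {poly R},
  [/\ (size P <= d - n)%N, (size Q <= d - n)%N &
      forall x, (n <= x < 2 * d - n)%N -> (P * A + Q * B)`_x = t x].
Proof.
rewrite /principal_subresultant /subresultant coef_poly ltnSn.
set e := (d - n)%N; set X := subresultant_mx _ _ _ _ _ => nd Xy.
pose c : 'cV[R]_(2 * e) :=
  y *: (\adj X *m \col_r t (sylvester_row d n n r)).
pose f (i : nat) : R := if insub i is Some l then c l 0 else 0.
have fE (l : 'I_(2 * e)) : f l = c l 0 by rewrite /f valK.
pose P := \poly_(i < e) f (e.-1 - i)%N.
pose Q := \poly_(i < e) f ((2 * e).-1 - i)%N.
exists P, Q; split; rewrite ?size_poly // => x /andP[nx xd].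
have xe : ((2 * d - n).-1 - x < 2 * e)%N by rewrite /e; lia.
have xE : sylvester_row d n n (Ordinal xe) = x.
  by rewrite /sylvester_row /=; case: ifP; move: xe; rewrite /e; lia.
have /matrixP/(_ (Ordinal xe) (Ordinal xe)) :=
  @mul_subresultant_mx d n n A B (fun=> P) (fun=> Q)
    (fun _ _ => size_poly _ _) (fun _ _ => size_poly _ _).
rewrite [X in _ = X -> _]mxE xE => <-.
have col_c : col (Ordinal xe) (cofactor_mx e (fun=> P) (fun=> Q)) = c.
  apply/matrixP => l z; rewrite ord1 -fE !mxE !coef_poly.
  have l2 := ltn_ord l; case: ifP => le.
    by rewrite ifT; [congr (f _); lia | lia].
  by rewrite ifT; [congr (f _); lia | lia].
transitivity ((X *m c) (Ordinal xe) 0).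
  rewrite -col_c mxE [RHS]mxE; apply: eq_bigr => l _.
  by rewrite [col _ _ _ _]mxE.
rewrite /c -scalemxAr mulmxA mul_mx_adj mul_scalar_mx scalerA mulrC Xy scale1r.
by rewrite mxE xE.
Qed.

(** Converse of [euclid_at_principal_subresultant]. [T] comes from prescribing the coefficients of
    ['X^n], and [S] from cancelling those of [D] in degrees at least [n]. At [n = d] the matrix is
    empty, and [euclid_at_top] is used instead. *)
Lemma principal_subresultant_euclid_at d n A B y :
  A \is monic -> size A = d.+1 -> B \is monic -> size B = d.+1 ->
  (n <= d)%N -> principal_subresultant d n A B * y = 1 ->
  exists U V U' V', euclid_at d n A B U V U' V'.
Proof.
rewrite leq_eqVlt => mA sA mB sB /predU1P[->|nd] Xy.
  by exists 1, 0, (-1), 1; apply: euclid_at_top.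
have size_comb P Q : (size P <= d - n)%N -> (size Q <= d - n)%N ->
    (size (P * A + Q * B)%R <= 2 * d - n)%N.
  move=> sP sQ; apply: leq_trans (size_polyD _ _) _; rewrite geq_max.
  have := size_polyMleq P A; have := size_polyMleq Q B; lia.
(* [D] puts the monic term ['X^(d - n)] into [V']. Its degree stays below [2 * d - n] because the
   leading terms of [A] and [B] cancel. *)
pose D := 'X^(d - n) * (B - A).
have sD : (size D <= 2 * d - n)%N.
  have := size_monicB mB sB mA sA; have := size_polyMleq 'X^(d - n) (B - A).
  by rewrite size_polyXn -/D; lia.
have [U [V [sU sV UV]]] :=
  subresultant_solve (fun x => (x == n)%:R) (ltnW nd) Xy.
have [P [Q [sP sQ PQ]]] := subresultant_solve (fun x => - D`_x) (ltnW nd) Xy.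
have sX : size ('X^(d - n) : {poly R}) = (d - n).+1 := size_polyXn _ _.
have Tn : (U * A + V * B)`_n = 1 by rewrite UV ?eqxx //; lia.
have sT : size (U * A + V * B) = n.+1.
  apply/eqP; rewrite eqn_leq; apply/andP; split; last first.
    rewrite ltnNge; apply/negP => /leq_sizeP/(_ n (leqnn _)).
    by rewrite Tn => /eqP; rewrite oner_eq0.
  apply/leq_sizeP => x nx; have [xd|xd] := ltnP x (2 * d - n).
    by rewrite UV ?gtn_eqF //; lia.
  by rewrite nth_default // (leq_trans (size_comb _ _ sU sV)).
exists U, V, (P - 'X^(d - n)), (Q + 'X^(d - n)); split => //.
- lia.
- rewrite addrC size_polyDl ?sX ?ltnS // monicE lead_coefDl ?sX ?ltnS //.
  by rewrite -monicE monicXn; split=> //; lia.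
- by split=> //; rewrite monicE lead_coefE sT /= Tn.
have -> : (P - 'X^(d - n)) * A + (Q + 'X^(d - n)) * B = P * A + Q * B + D.
  by rewrite /D; ring.
apply/leq_sizeP => x nx; rewrite coefD; have [xd|xd] := ltnP x (2 * d - n).
  by rewrite PQ ?addNr //; lia.
rewrite !nth_default ?addr0 // ?(leq_trans sD) //.
by rewrite (leq_trans (size_comb _ _ sP sQ)).
Qed.

End sylvester.

(** * Monic polynomials and tuples of coefficients *)

Section monic_of.
Variables (R : comNzRingType) (d : nat).
Implicit Types (t : d.-tuple R) (A : {poly R}).

Lemma size_Poly_tuple t : (size (Poly t) <= d)%N.
Proof. by rewrite (leq_trans (size_Poly _)) ?size_tuple. Qed.

Lemma Poly_tuple_inj : injective (fun t => Poly t).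
Proof.
move=> t u /polyP tu; apply: eq_from_tnth => i.
by have := tu i; rewrite !coef_Poly !(tnth_nth 0).
Qed.

Lemma size_monic_of t : size (monic_of t) = d.+1.
Proof.
by rewrite /monic_of size_polyDl size_polyXn // ltnS size_Poly_tuple.
Qed.

Lemma monic_monic_of t : monic_of t \is monic.
Proof.
rewrite monicE lead_coefDl ?size_polyXn ?ltnS ?size_Poly_tuple //.
by rewrite -monicE monicXn.
Qed.

Lemma monic_of_inj : injective (@monic_of R d).
Proof. by move=> t u /addrI/Poly_tuple_inj. Qed.

Definition coef_tuple A : d.-tuple R := [tuple A`_i | i < d].

Lemma coef_tupleK A : (size A <= d)%N -> Poly (coef_tuple A) = A.
Proof.
move=> sA; apply/polyP => i; rewrite coef_Poly.
have [id|di] := ltnP i d; last first.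
  by rewrite !nth_default ?size_tuple // (leq_trans sA).
by rewrite -(tnth_nth 0 (coef_tuple A) (Ordinal id)) tnth_mktuple.
Qed.

Lemma Poly_tupleK t : coef_tuple (Poly t) = t.
Proof. by apply: Poly_tuple_inj; rewrite /= coef_tupleK // size_Poly_tuple. Qed.

Lemma monic_of_surj A : A \is monic -> size A = d.+1 ->
  exists t, monic_of t = A.
Proof.
move=> mA sA; exists (coef_tuple (A - 'X^d)).
rewrite /monic_of coef_tupleK ?subrKC // size_monicB ?monicXn //.
exact: size_polyXn.
Qed.
End monic_of.

(** * Counting over finite rings *)

Section counting.
Variables (R : finComNzRingType) (d : nat).
Let pairs := (d.-tuple R * d.-tuple R)%type.
Implicit Types (ab : pairs) (n : nat) (U V : {poly R}).

Definition euclid_pair n ab U V U' V' :=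
  euclid_at d n (monic_of ab.1) (monic_of ab.2) U V U' V'.

Definition euclid_rem ab U' V' : {poly R} :=
  U' * monic_of ab.1 + V' * monic_of ab.2.

(** For [Y] the full set this is goodness at degree [n]; a general [Y] also prescribes the next
    remainder. *)
Definition euclid_good n (Y : {set n.-tuple R}) : {set pairs} :=
  [set ab | `[< exists U V U' V', euclid_pair n ab U V U' V' /\
                  coef_tuple n (euclid_rem ab U' V') \in Y >]].

Lemma euclid_goodP n (Y : {set n.-tuple R}) ab :
  reflect (exists U V U' V', euclid_pair n ab U V U' V' /\
             coef_tuple n (euclid_rem ab U' V') \in Y)
          (ab \in euclid_good Y).
Proof. by rewrite inE; apply: asboolP. Qed.

Lemma euclid_pair_unique n ab U V U' V' P Q P' Q' :
  euclid_pair n ab U V U' V' -> euclid_pair n ab P Q P' Q' ->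
  [/\ P = U, Q = V, P' = U' & Q' = V'].
Proof.
by apply: euclid_at_unique; [exact: monic_monic_of | exact: size_monic_of].
Qed.

Definition is_translate n ab (C : {poly R}) ab' U V U' V' :=
  [/\ monic_of ab'.1 = monic_of ab.1 - C * V,
      monic_of ab'.2 = monic_of ab.2 + C * U,
      euclid_pair n ab' U V U' V'
    & euclid_rem ab' U' V' = euclid_rem ab U' V' + C].

Lemma euclid_pair_translate n ab (C : {poly R}) U V U' V' :
  (size C <= n)%N -> euclid_pair n ab U V U' V' ->
  exists ab', is_translate n ab C ab' U V U' V'.
Proof.
move=> sC E.
have [[mA sA] [mB sB] E' eS] := euclid_at_translate (monic_monic_of ab.1)
  (size_monic_of ab.1) (monic_monic_of ab.2) (size_monic_of ab.2) E sC.
have [a aE] := monic_of_surj mA sA; have [b bE] := monic_of_surj mB sB.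
by exists (a, b); rewrite /is_translate /euclid_pair /euclid_rem aE bE.
Qed.

Lemma is_translate_inj n ab1 ab2 C ab' U V U' V' :
  is_translate n ab1 C ab' U V U' V' -> is_translate n ab2 C ab' U V U' V' ->
  ab1 = ab2.
Proof.
move=> [a1 b1 _ _] [a2 b2 _ _]; move: a2 b2; rewrite a1 b1.
move=> /addIr/monic_of_inj a /addIr/monic_of_inj b.
by rewrite [ab1]surjective_pairing [ab2]surjective_pairing a b.
Qed.

(** The pairs of [G0], with remainder 0, are base points: their translates by all [C] cover the good
    pairs, and their translates by [Y] are distinct pairs with remainder in [Y]. *)
Lemma card_euclid_good n (Y : {set n.-tuple R}) :
  (#|euclid_good [set: n.-tuple R]| * #|Y| <=
   #|euclid_good Y| * #|R| ^ n)%N.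
Proof.
pose zero := coef_tuple n (0 : {poly R}).
pose G0 := euclid_good [set zero].
(* Uniqueness of the cofactors makes the translate a function of the pair and of [C]; its value is
   arbitrary on pairs without cofactors. *)
have /choice[f fP] : forall abc : pairs * n.-tuple R, exists ab',
    forall U V U' V', euclid_pair n abc.1 U V U' V' ->
      is_translate n abc.1 (Poly abc.2) ab' U V U' V'.
  move=> [ab c] /=.
  have [[U [V [U' [V' E]]]]|nE] :=
      pselect (exists U V U' V', euclid_pair n ab U V U' V'); last first.
    exists ab => U V U' V' E; exfalso; apply: nE.
    by exists U, V, U', V'.
  have [ab' T] := euclid_pair_translate (size_Poly_tuple c) E.
  by exists ab' => P Q P' Q' /(euclid_pair_unique E) [-> -> -> ->].
have G0P ab : ab \in G0 -> exists U V U' V',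
    euclid_pair n ab U V U' V' /\ euclid_rem ab U' V' = 0.
  move=> /euclid_goodP[U [V [U' [V' [E]]]]]; rewrite inE => /eqP z.
  exists U, V, U', V'; split => //.
  case: E => _ _ _ sS; rewrite -[LHS](coef_tupleK sS).
  by rewrite -/(euclid_rem ab U' V') z coef_tupleK // size_poly0.
have le1 : (#|euclid_good [set: n.-tuple R]| <= #|G0| * #|R| ^ n)%N.
  rewrite -card_tuple -[#|{: n.-tuple R}|]cardsT -cardsX.
  apply: leq_trans (leq_imset_card f _); apply: subset_leq_card.
  apply/fintype.subsetP => ab /euclid_goodP[U [V [U' [V' [E _]]]]].
  have sS : (size (euclid_rem ab U' V') <= n)%N by case: E.
  (* Translating by minus the remainder lands in [G0], and translating back by the remainder
     recovers [ab]. *)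
  have sNS : (size (- euclid_rem ab U' V') <= n)%N by rewrite size_polyNE.
  have [ab0 [a0 b0 E0 S0]] := euclid_pair_translate sNS E.
  have [a1 b1 E1 S1] :=
    fP (ab0, coef_tuple n (euclid_rem ab U' V')) _ _ _ _ E0.
  apply/imsetP; exists (ab0, coef_tuple n (euclid_rem ab U' V')).
    rewrite finset.in_setX finset.in_setT andbT; apply/euclid_goodP.
    exists U, V, U', V'.
    by split=> //; rewrite S0 subrr inE.
  rewrite /= coef_tupleK // in a1 b1.
  rewrite [LHS]surjective_pairing [RHS]surjective_pairing; congr pair.
    by apply: monic_of_inj; rewrite a1 a0; ring.
  by apply: monic_of_inj; rewrite b1 b0; ring.
have le2 : (#|G0| * #|Y| <= #|euclid_good Y|)%N.
  rewrite -cardsX -(card_in_imset (f := f)).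
    apply: subset_leq_card; apply/fintype.subsetP => ab' /imsetP[[ab c]].
    rewrite finset.in_setX /= => /andP[/G0P[U [V [U' [V' [E z]]]]] cY] {ab'}->.
    have [_ _ E' S'] := fP (ab, c) _ _ _ _ E.
    apply/euclid_goodP; exists U, V, U', V'; split => //.
    by rewrite S' z add0r /= Poly_tupleK.
  move=> [ab1 c1] [ab2 c2]; rewrite !finset.in_setX /=.
  move=> /andP[/G0P[U [V [U' [V' [E z]]]]] _].
  move=> /andP[/G0P[P [Q [P' [Q' [F y]]]]] _] ef.
  have T1 := fP (ab1, c1) _ _ _ _ E; have T2 := fP (ab2, c2) _ _ _ _ F.
  rewrite -ef in T2; have [_ _ E1 S1] := T1; have [_ _ E2 S2] := T2.
  have [eP eQ eP' eQ'] := euclid_pair_unique E1 E2; subst P Q P' Q'.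
  move: S2; rewrite S1 /= z y !add0r => /Poly_tuple_inj c12.
  by subst c2; congr pair; apply: is_translate_inj T1 T2.
apply: leq_trans (leq_mul le1 (leqnn _)) _; rewrite mulnAC.
by rewrite leq_mul.
Qed.

(** Sending [(ab, x)], with [ab] not good, to a translate of [ab] is injective, and there are
    [#|R| ^ (2 * d)] pairs in all. Invertibility of nonzero elements lets every division step be
    carried out. *)
Lemma card_not_euclid_good n : (n <= d)%N ->
  (forall x : R, x != 0 -> exists y, y * x = 1) ->
  (#|~: euclid_good [set: n.-tuple R]| * #|R| <= #|R| ^ (2 * d))%N.
Proof.
move=> nd Rfield.
have goodP k ab : reflect (exists U V U' V', euclid_pair k ab U V U' V')
    (ab \in euclid_good [set: k.-tuple R]).
  apply: (iffP (euclid_goodP _ _)).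
    by move=> [U [V [U' [V' [E _]]]]]; exists U, V, U', V'.
  by move=> [U [V [U' [V' E]]]]; exists U, V, U', V'; rewrite inE.
(* [k] is the degree of the last remainder before the sequence skips [n];
   translating the next remainder by [x *: 'X^n] does not change [k]. *)
have /choice[f fP] : forall abx : pairs * R, exists ab',
    abx.1 \notin euclid_good [set: n.-tuple R] ->
    exists k U V U' V', [/\ (n < k)%N, euclid_pair k abx.1 U V U' V',
      (size (euclid_rem abx.1 U' V') <= n)%N
    & is_translate k abx.1 (abx.2 *: 'X^n) ab' U V U' V'].
  move=> [ab x] /=; have [g|ng] := boolP (ab \in euclid_good [set: n.-tuple R]).
    by exists ab.
  have exk : exists k, (n < k)%N && (ab \in euclid_good [set: k.-tuple R]).
    exists d; apply/andP; split.
      rewrite ltn_neqAle nd andbT; apply: contraNneq ng => ->; apply/goodP.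
      by exists 1, 0, (-1), 1; apply: euclid_at_top;
        rewrite ?monic_monic_of ?size_monic_of.
    apply/goodP; exists 1, 0, (-1), 1; apply: euclid_at_top;
        by rewrite ?monic_monic_of ?size_monic_of.
  have [k /andP[nk /goodP[U [V [U' [V' E]]]]] kmin] := ex_minnP exk.
  (* A remainder of degree [i >= n] would allow one more division step: [i = n] would make the pair
     good, and [i > n] would contradict the minimality of [k]. *)
  have sS : (size (euclid_rem ab U' V') <= n)%N.
    rewrite leqNgt; apply/negP => nS.
    set i := (size (euclid_rem ab U' V')).-1.
    have iS : size (euclid_rem ab U' V') = i.+1 by rewrite /i; lia.
    have [|y yS] := Rfield (lead_coef (euclid_rem ab U' V')).
      by rewrite lead_coef_eq0 -size_poly_eq0 iS.
    have /goodP gi := euclid_at_step E iS yS.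
    have ik : (i < k)%N by case: E => _ _ _; rewrite -/(euclid_rem _ _ _) iS.
    move: nS; rewrite iS ltnS leq_eqVlt => /predU1P[ni|ni].
      by move: ng; rewrite ni gi.
    by have := kmin i; rewrite ni gi leqNgt ik => /(_ isT).
  have sC : (size (x *: 'X^n) <= k)%N.
    by rewrite (leq_trans (size_scale_leq _ _)) ?size_polyXn.
  have [ab' T] := euclid_pair_translate sC E.
  by exists ab' => _; exists k, U, V, U', V'.
rewrite -[#|R| in X in (X <= _)%N]cardsT -cardsX -(card_in_imset (f := f)).
  apply: leq_trans (max_card _) _.
  by rewrite card_prod !card_tuple mul2n -addnn expnD.
have size_trans k ab x ab' U V U' V' : (size (euclid_rem ab U' V') <= n)%N ->
    is_translate k ab (x *: 'X^n) ab' U V U' V' ->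
    (size (euclid_rem ab' U' V') <= n.+1)%N.
  move=> sS [_ _ _ ->]; rewrite (leq_trans (size_polyD _ _)) // geq_max.
  rewrite (leq_trans sS) // (leq_trans (size_scale_leq _ _)) //.
  by rewrite size_polyXn.
(* If [l > k], the remainder at level [l] is small enough for [euclid_at_eq0] at level [k], which
   forces the monic [V'] to vanish. Hence the translate determines the level. *)
have level_le k l ab P Q P' Q' U V U' V' : (n < k)%N ->
    euclid_pair k ab P Q P' Q' -> euclid_pair l ab U V U' V' ->
    (size (euclid_rem ab U' V') <= n.+1)%N -> (l <= k)%N.
  move=> nk E [_ [mV' sV'] _ _] sS; rewrite leqNgt; apply/negP => kl.
  have [||_ V0] := euclid_at_eq0 (monic_monic_of _) (size_monic_of _) E
    (P := U') (Q := V').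
  - lia.
  - exact: leq_trans sS nk.
  by move: mV'; rewrite V0 monicE lead_coef0 eq_sym oner_eq0.
move=> [ab1 x1] [ab2 x2]; rewrite !finset.in_setX /=.
move=> /andP[]; rewrite finset.in_setC => g1 _.
move=> /andP[]; rewrite finset.in_setC => g2 _ ef.
have [k1 [U [V [U' [V' [nk1 E1 s1 T1]]]]]] := fP (ab1, x1) g1.
have [k2 [P [Q [P' [Q' [nk2 E2 s2 T2]]]]]] := fP (ab2, x2) g2.
rewrite -ef in T2; rewrite /= in s1 s2 E1 E2 T1 T2.
have [_ _ F1 S1] := T1; have [_ _ F2 S2] := T2.
have k12 : k1 = k2.
  apply/eqP; rewrite eqn_leq.
  have l1 := size_trans _ _ _ _ _ _ _ _ s1 T1.
  have l2 := size_trans _ _ _ _ _ _ _ _ s2 T2.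
  by rewrite (level_le _ _ _ _ _ _ _ _ _ _ _ nk2 F2 F1 l1)
             (level_le _ _ _ _ _ _ _ _ _ _ _ nk1 F1 F2 l2).
subst k2; have [eP eQ eP' eQ'] := euclid_pair_unique F1 F2; subst P Q P' Q'.
(* Both original remainders have degree less than [n], so [x] is the coefficient of ['X^n] in the
   common translated remainder. *)
have x12 : x1 = x2.
  move: S2; rewrite S1.
  move: (euclid_rem ab1 U' V') (euclid_rem ab2 U' V') s1 s2.
  move=> r1 r2 s1 s2 /polyP/(_ n).
  rewrite !coefD !coefZ coefXn eqxx !mulr1.
  by rewrite (nth_default _ s1) (nth_default _ s2) !add0r.
by subst x2; congr pair; apply: is_translate_inj T1 T2.
Qed.

End counting.

(** * Discrete valuation rings *)

Section dvr.
Local Open Scope quotient_scope.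
Local Open Scope ring_scope.
Variable W : dvrType.
Implicit Types x y : W.

Lemma ex_uniformizer :
  exists a : W, forall x, x \in @maxideal W <-> exists y, x = y * a.
Proof. exact: (@dvr_principal W (@maxideal W) (@maxideal_idealr_closed W)). Qed.

Definition uniformizer : W := sval (cid ex_uniformizer).
Local Notation pi := uniformizer.

Lemma maxidealE x : x \in @maxideal W <-> exists y, x = y * pi.
Proof. exact: svalP (cid ex_uniformizer) x. Qed.

Lemma uniformizer_neq0 : pi != 0.
Proof.
have [_ _ [x /maxidealE[y ->]]] := maxidealP W.
by apply: contraNneq => ->; rewrite mulr0.
Qed.

Lemma maxideal_powP n x : maxideal_pow n x <-> exists y, x = y * pi ^+ n.
Proof.
split=> [[k [c [f [fm ->]]]]|[y ->]]; last first.
  exists 1%N, (fun=> y), (fun _ _ => pi); split.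
    by move=> _ _; apply/maxidealE; exists 1; rewrite mul1r.
  by rewrite big_ord1 prodr_const card_ord.
apply: (big_ind (fun x => exists y, x = y * pi ^+ n)).
- by exists 0; rewrite mul0r.
- by move=> _ _ [u ->] [v ->]; exists (u + v); rewrite mulrDl.
move=> i _; have /choice[g fg] : forall l, exists y, f i l = y * pi.
  by move=> l; apply/maxidealE.
exists (c i * \prod_l g l); rewrite (eq_bigr _ (fun l _ => fg l)).
by rewrite big_split /= prodr_const card_ord mulrA.
Qed.

Lemma maxideal_powD n x y :
  maxideal_pow n x -> maxideal_pow n y -> maxideal_pow n (x + y).
Proof.
move=> /maxideal_powP[u ->] /maxideal_powP[v ->]; apply/maxideal_powP.
by exists (u + v); rewrite mulrDl.
Qed.

Lemma maxideal_powMl n x y : maxideal_pow n y -> maxideal_pow n (x * y).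
Proof.
move=> /maxideal_powP[u ->]; apply/maxideal_powP.
by exists (x * u); rewrite mulrA.
Qed.

Lemma maxideal_powN n x : maxideal_pow n x -> maxideal_pow n (- x).
Proof. by rewrite -mulN1r => /maxideal_powMl; apply. Qed.

Lemma maxideal_powB n x y :
  maxideal_pow n x -> maxideal_pow n y -> maxideal_pow n (x - y).
Proof. by move=> xn /maxideal_powN; apply: maxideal_powD. Qed.

Lemma maxideal_pow_0 n : maxideal_pow n (0 : W).
Proof. by apply/maxideal_powP; exists 0; rewrite mul0r. Qed.

Lemma maxideal_pow0 x : maxideal_pow 0 x.
Proof. by apply/maxideal_powP; exists x; rewrite mulr1. Qed.

Lemma maxideal_powS_le n k x : (k <= n)%N ->
  maxideal_pow n x -> maxideal_pow k x.
Proof.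
move=> kn /maxideal_powP[y ->]; apply/maxideal_powP.
by exists (y * pi ^+ (n - k)); rewrite -mulrA -exprD subnK.
Qed.

Lemma maxideal_pow1 x : maxideal_pow 1 x <-> x \in @maxideal W.
Proof. by rewrite maxideal_powP maxidealE. Qed.

Lemma maxideal_powMpi n k x :
  maxideal_pow (k + n) (pi ^+ k * x) -> maxideal_pow n x.
Proof.
move=> /maxideal_powP[y]; rewrite exprD mulrCA => /mulfI ->.
  by apply/maxideal_powP; exists y.
by rewrite expf_neq0 // uniformizer_neq0.
Qed.

(** The exponent is shifted because [idealr_closed] requires a proper ideal, which rules out the
    power 0. *)
Definition pow_ideal n : W -> bool := fun x => `[< maxideal_pow n.+1 x >].

Lemma pow_ideal_closed n : idealr_closed (pow_ideal n).
Proof.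
split=> [||a x y].
- by apply/asboolP; apply: maxideal_pow_0.
- apply/negP => /asboolP/(@maxideal_powS_le _ 1)-/(_ isT)/maxideal_pow1.
  by have [_ /negP] := @maxideal_idealr_closed W.
- move=> /asboolP xn /asboolP yn; apply/asboolP.
  by apply: maxideal_powD => //; apply: maxideal_powMl.
Qed.

HB.instance Definition _ n :=
  isIdealr.Build W (pow_ideal n) (@pow_ideal_closed n).

Definition dvr_quot n : comNzRingType := {ideal_quot (pow_ideal n : idealr W)}.

Lemma dvr_quot_eq n x y :
  \pi_(dvr_quot n) x = \pi_(dvr_quot n) y <-> maxideal_pow n.+1 (x - y).
Proof.
split=> [/eqP|H].
  by rewrite -[_ == _]Quotient.idealrBE => /asboolP.
by apply/eqP; rewrite -[_ == _]Quotient.idealrBE; apply/asboolP.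
Qed.

Section digits.
Variables (q : nat) (D : 'I_q -> W).
Hypothesis D_surj : forall x, exists a, maxideal_pow 1 (x - D a).
Hypothesis D_inj : forall a b, maxideal_pow 1 (D a - D b) -> a = b.

(** Horner form of a truncated base-[pi] expansion, least significant digit first. Tuples of length
    [n] parametrise [W] modulo [pi ^+ n]. *)
Definition digit_sum (t : seq 'I_q) : W := foldr (fun a v => D a + pi * v) 0 t.

Lemma digit_sum_surj n x :
  exists t : n.-tuple 'I_q, maxideal_pow n (x - digit_sum t).
Proof.
elim: n x => [|n IHn] x; first by exists [tuple]; apply: maxideal_pow0.
have [a /maxideal_powP[y]] := D_surj x; rewrite expr1 => xa.
have [t /maxideal_powP[z yt]] := IHn y; exists [tuple of a :: t].
apply/maxideal_powP; exists z => /=.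
by rewrite opprD addrA xa exprS mulrCA -yt; ring.
Qed.

Lemma digit_sum_inj n (t u : n.-tuple 'I_q) :
  maxideal_pow n (digit_sum t - digit_sum u) -> t = u.
Proof.
elim: n t u => [|n IHn] t u; first by rewrite (tuple0 t) (tuple0 u).
case: (tupleP t) => a {}t; case: (tupleP u) => b {}u /= tu.
have ab : a = b.
  apply: D_inj; have := @maxideal_powS_le n.+1 1 _ isT tu.
  move=> /maxideal_powP[y yE]; apply/maxideal_powP.
  exists (y - digit_sum t + digit_sum u); rewrite mulrDl mulrBl -yE expr1.
  by ring.
rewrite ab in tu *; congr [tuple of _ :: _]; apply: IHn.
apply: (@maxideal_powMpi _ 1); move: tu; rewrite expr1 add1n.
by have -> : D b + pi * digit_sum t - (D b + pi * digit_sum u) =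
  pi * (digit_sum t - digit_sum u) by ring.
Qed.
End digits.

Lemma ex_digits q : ([set: residue_field W] #= `I_q)%card ->
  exists D : 'I_q -> W, (forall x, exists a, maxideal_pow 1 (x - D a)) /\
    (forall a b, maxideal_pow 1 (D a - D b) -> a = b).
Proof.
move=> /card_set_bijP[e [efun einj esurj]].
have piE x y : \pi_(residue_field W) x = \pi_(residue_field W) y <->
    maxideal_pow 1 (x - y).
  rewrite maxideal_pow1; split=> [/eqP|H].
    by rewrite -[_ == _]Quotient.idealrBE.
  by apply/eqP; rewrite -[_ == _]Quotient.idealrBE.
have /choice[D DE] : forall a : 'I_q, exists w : W,
    e (\pi_(residue_field W) w) = a.
  move=> a; have [s _ sE] := esurj a (ltn_ord a).
  by exists (repr s); rewrite reprK.
exists D; split=> [x|a b /piE ab].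
  have lt_e : (e (\pi_(residue_field W) x) < q)%N by apply: efun.
  exists (Ordinal lt_e); apply/piE/einj; rewrite ?in_setT //.
by apply: val_inj; rewrite /= -!DE ab.
Qed.

(** Digit expansions of length [n.+1] enumerate the quotient, and [pi ^+ i] times those of length
    [n.+1 - i] enumerate the image of the [i]-th power of the maximal ideal. *)
Lemma ex_finite_quotient q n : ([set: residue_field W] #= `I_q)%card ->
  exists (S : finComNzRingType) (f : {rmorphism W -> S}),
  [/\ forall s, exists x, f x = s,
      forall x y, f x = f y <-> maxideal_pow n.+1 (x - y),
      #|S| = (q ^ n.+1)%N
    & forall i, (i <= n.+1)%N ->
        #|[set s : S | `[< exists2 x, maxideal_pow i x & f x = s >]]%SET| =
        (q ^ (n.+1 - i))%N].
Proof.
move=> /ex_digits[D [Dsurj Dinj]].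
pose g (t : n.+1.-tuple 'I_q) : dvr_quot n := \pi_(dvr_quot n) (digit_sum D t).
have gI : injective g.
  by move=> t u /dvr_quot_eq; apply: digit_sum_inj.
have /choice[h hK] : forall s, exists t, g t = s.
  move=> s; have [t tE] := digit_sum_surj Dsurj n.+1 (repr s).
  by exists t; rewrite -[s]reprK; apply/esym/dvr_quot_eq.
have gK : cancel g h by move=> t; apply: gI; rewrite hK.
(* The carrier and ring structure stay those of [dvr_quot n]; only countability and finiteness are
   transported along [h]. *)
pose cM := CanIsCountable hK.
pose cT : countType := HB.pack (GRing.ComNzRing.sort (dvr_quot n)) cM.
pose fM := @PCanIsFinite cT _ h _ (can_pcan hK).
pose S : finComNzRingType := HB.pack (GRing.ComNzRing.sort (dvr_quot n)) cM fM.
exists S, (\pi_(dvr_quot n) : {rmorphism W -> dvr_quot n}); split.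
- by move=> s; exists (repr (s : dvr_quot n)); exact: (reprK (s : dvr_quot n)).
- exact: dvr_quot_eq.
- have : bijective (g : _ -> S) by exists h.
  by move=> /bij_eq_card <-; rewrite card_tuple card_ord.
move=> i iN.
pose k (t : (n.+1 - i).-tuple 'I_q) : S :=
  \pi_(dvr_quot n) (pi ^+ i * digit_sum D t).
have kI : injective k.
  move=> t u /dvr_quot_eq; rewrite -mulrBr -{1}(subnKC iN) => /maxideal_powMpi.
  exact: digit_sum_inj.
transitivity #|(k @: [set: (n.+1 - i).-tuple 'I_q])%SET|; last first.
  by rewrite card_imset // cardsT card_tuple card_ord.
apply: eq_card => s; rewrite !inE; apply/asboolP/imsetP.
  move=> [_ /maxideal_powP[x ->] <-].
  have [t tE] := digit_sum_surj Dsurj (n.+1 - i) x; exists t => //.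
  apply/dvr_quot_eq; rewrite mulrC -mulrBr.
  move/maxideal_powP: tE => [z ->]; apply/maxideal_powP; exists z.
  by rewrite mulrCA -exprD subnKC.
move=> [t _ ->]; exists (pi ^+ i * digit_sum D t) => //.
by apply/maxideal_powP; exists (digit_sum D t); rewrite mulrC.
Qed.

End dvr.

(** * Valuations and the decomposition by minimal valuation *)

Section valuation.
Variables (W : dvrType) (R : realType).
Implicit Types x : W.

Lemma valuation_geP n x : (n%:R%:E <= valuation R x)%E <-> maxideal_pow n x.
Proof.
split=> [|xn]; last by apply: ereal_sup_ubound; exists n.
case: n => [|n]; first by move=> _; apply: maxideal_pow0.
move=> le_n; apply: contrapT => nx.
have : (valuation R x <= n%:R%:E)%E.
  apply: ge_ereal_sup => _ [k xk <-]; rewrite lee_fin ler_nat leqNgt.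
  by apply/negP => nk; apply: nx; apply: maxideal_powS_le xk.
by move/(le_trans le_n); rewrite lee_fin ler_nat ltnn.
Qed.

(** Cuts the event that [delta] is at least [m] into disjoint pieces, by the exact minimal valuation
    [w]. Each piece is stated with powers of the maximal ideal only, so that a finite quotient
    detects it. *)
Definition delta_level j m w (c : nat -> W) : Prop :=
  [/\ forall k, (k <= j)%N -> maxideal_pow w (c k),
      exists2 k, (k <= j)%N & ~ maxideal_pow w.+1 (c k)
    & maxideal_pow (w + m) (c j)].

Lemma delta_level_fun j m w w' (c : nat -> W) :
  delta_level j m w c -> delta_level j m w' c -> w = w'.
Proof.
move=> [a1 [k kj nk] _] [b1 [l lj nl] _].
apply/eqP; rewrite eqn_leq; apply/andP; split; rewrite leqNgt; apply/negP => lt.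
  by apply: nl; apply: maxideal_powS_le lt _; apply: a1.
by apply: nk; apply: maxideal_powS_le lt _; apply: b1.
Qed.

Lemma bigmin_valuation j w (c : nat -> W) :
  (forall k, (k <= j)%N -> maxideal_pow w (c k)) ->
  (exists2 k, (k <= j)%N & ~ maxideal_pow w.+1 (c k)) ->
  (\big[mine/+oo]_(k < j.+1) valuation R (c k) = w%:R%:E)%E.
Proof.
move=> cw [k kj nk]; apply/eqP; rewrite eq_le; apply/andP; split; last first.
  apply/bigmin_geP; split=> [|i _]; first by rewrite leey.
  by apply/valuation_geP; apply: cw; rewrite -ltnS.
apply: (le_trans (bigmin_le _ (Ordinal (kj : k < j.+1)%N) _)) => /=.
apply: ge_ereal_sup => _ [l xl <-]; rewrite lee_fin ler_nat leqNgt.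
by apply/negP => wl; apply: nk; apply: maxideal_powS_le xl.
Qed.

Lemma delta_levelP j m (c : nat -> W) :
  (m%:R%:E <= valuation R (c j) -
     \big[mine/+oo]_(k < j.+1) valuation R (c k))%E <->
  exists w, delta_level j m w c.
Proof.
split=> [|[w [cw ncw cj]]]; last first.
  rewrite (bigmin_valuation cw ncw) leeBrDr // -EFinD -natrD addnC.
  exact/valuation_geP.
(* If all coefficients lie in every power, the minimum is [+oo] and the difference [-oo]: the
   inequality fails, and no level exists either. *)
have [fin|inf] := pselect (exists w, exists2 k, (k <= j)%N &
    ~ maxideal_pow w.+1 (c k)); last first.
  have call w k : (k <= j)%N -> maxideal_pow w (c k).
    move=> kj; apply: contrapT => nk; case: w nk => [|w] nk.
      by apply: nk; apply: maxideal_pow0.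
    by apply: inf; exists w, k.
  have -> : (\big[mine/+oo]_(k < j.+1) valuation R (c k) = +oo)%E.
    apply/eqP; rewrite -leye_eq; apply/bigmin_geP; split=> // i _.
    rewrite leye_eq; apply/eqP/eqyP => A A0.
    have ci : maxideal_pow (Num.truncn A).+1 (c i).
      by apply: call; rewrite -ltnS.
    move/valuation_geP: ci; apply: le_trans; rewrite lee_fin ltW //.
    exact: truncnS_gt.
  by rewrite /= addeNy leeNy_eq.
have {}fin : exists w, `[< exists2 k, (k <= j)%N & ~ maxideal_pow w.+1 (c k) >].
  by have [w cw] := fin; exists w; apply/asboolP.
have [w /asboolP ncw wmin] := ex_minnP fin.
have cw k : (k <= j)%N -> maxideal_pow w (c k).
  move=> kj; apply: contrapT; case: w ncw wmin => [|w] ncw wmin nk.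
    by apply: nk; apply: maxideal_pow0.
  have : (w < w)%N by apply: wmin; apply/asboolP; exists k.
  by rewrite ltnn.
rewrite (bigmin_valuation cw ncw) leeBrDr // -EFinD -natrD addnC.
by move=> /valuation_geP cj; exists w.
Qed.

(** The powers tested are [w], [w.+1] and [w + m], all at most [(w + m).+1]; the successor matters
    when [m = 0]. *)
Lemma delta_level_eqmod j m w (c c' : nat -> W) :
  (forall k, maxideal_pow (w + m).+1 (c k - c' k)) ->
  delta_level j m w c -> delta_level j m w c'.
Proof.
move=> cc' [cw [k kj nk] cj].
have tr l i : (i <= (w + m).+1)%N ->
    maxideal_pow i (c l) <-> maxideal_pow i (c' l).
  move=> iN; have H := maxideal_powS_le iN (cc' l); split=> ci.
    by have := maxideal_powB ci H; rewrite opprB addrC subrK.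
  by have := maxideal_powD H ci; rewrite subrK.
split.
- by move=> l lj; apply/tr; [lia | exact: cw].
- by exists k => // /tr H; apply: nk; apply: H; lia.
- by apply/tr; [lia |].
Qed.

End valuation.

(** * Haar measure and finite quotients *)

Section fin_preimage.
Context (disp : measure_display) (T : measurableType disp) (R : realType).
Context (S : finType) (f : T -> S).
Hypothesis mf : forall s, measurable [set x | f x = s].

Lemma preim_cons a (s : seq S) :
  [set x | f x \in a :: s] = [set x | f x = a] `|` [set x | f x \in s].
Proof.
apply/seteqP; split=> x /=; first by rewrite inE => /predU1P.
by rewrite inE => -[->|->]; rewrite ?eqxx ?orbT.
Qed.

Lemma measurable_preim_seq (s : seq S) : measurable [set x | f x \in s].
Proof.
elim: s => [|a s IHs]; last by rewrite preim_cons; apply: measurableU.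
by rewrite (_ : [set x | _] = set0) //; apply/seteqP; split.
Qed.

Lemma measurable_preim_fin (E : {set S}) : measurable [set x | f x \in E].
Proof.
have := measurable_preim_seq (enum E).
by under eq_set do rewrite mem_enum.
Qed.

Lemma measure_preim_fin (P : {measure set T -> \bar R}) (c : R) (E : {set S}) :
  (forall s, P [set x | f x = s] = c%:E) ->
  P [set x | f x \in E] = (#|E|%:R * c)%:E.
Proof.
move=> Pc.
have seqE (s : seq S) : uniq s -> P [set x | f x \in s] = ((size s)%:R * c)%:E.
  elim: s => [_|a s IHs /= /andP[nas us]].
    rewrite (_ : [set x | _] = set0); last by apply/seteqP; split.
    by rewrite measure0 mul0r.
  rewrite preim_cons measureU //; last 2 first.
  - exact: measurable_preim_seq.
  - by apply/seteqP; split=> // x [/= ->]; apply/negP.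
  transitivity (c%:E + ((size s)%:R * c)%:E)%E.
    by congr (_ + _)%E; [exact: Pc | exact: IHs].
  by rewrite -EFinD -natr1 mulrDl mul1r addrC.
have := seqE (enum E) (enum_uniq _); rewrite -cardE.
by under eq_set do rewrite mem_enum.
Qed.

End fin_preimage.

Section quotient.
Variables (W : dvrType) (R : realType) (mu : probability (borel_dvr W) R).
Hypothesis mu_haar : is_haar mu.
Variables (S : finComNzRingType) (f : {rmorphism W -> S}) (n : nat).
Hypothesis f_surj : forall s, exists x, f x = s.
Hypothesis f_eq : forall x y, f x = f y <-> maxideal_pow n.+1 (x - y).

Lemma measurable_fiber s : measurable ([set x | f x = s] : set (borel_dvr W)).
Proof.
apply: sub_sigma_algebra => x /= <-; exists n.+1 => y.
by move=> /f_eq.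
Qed.

(** The fibres are translates of one another, so invariance gives them equal measures, which add up
    to 1. *)
Lemma haar_fiber s : mu [set x | f x = s] = (#|S|%:R^-1)%:E.
Proof.
have cE t : mu [set x | f x = t] = (fine (mu [set x | f x = 0]))%:E.
  rewrite fineK; last exact: fin_num_measure (measurable_fiber _).
  have [x xt] := f_surj t.
  rewrite -(mu_haar x (measurable_fiber 0)); congr (mu _).
  apply/seteqP; split=> [y /= yt|_ [y /= y0 <-]]; last first.
    by rewrite rmorphD xt y0 addr0.
  exists ((y : W) - x); last exact: subrKC.
  by rewrite /= rmorphB yt xt subrr.
have e1 : 1 = #|S|%:R * fine (mu [set x | f x = 0]).
  apply: EFin_inj; rewrite -cardsT -(measure_preim_fin measurable_fiber _ cE).
  rewrite -(probability_setT mu); congr (mu _).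
  by apply/seteqP; split=> x //= _; rewrite in_setT.
rewrite cE; congr EFin.
have S0 : #|S|%:R != 0 :> R.
  by apply/eqP => S0; move: e1; rewrite S0 mul0r => /eqP; rewrite oner_eq0.
by apply: (mulfI S0); rewrite -e1 divff.
Qed.

Lemma measurable_tuple_fiber k (s : k.-tuple S) :
  measurable [set t : k.-tuple (borel_dvr W) | map_tuple f t = s].
Proof.
rewrite (_ : [set t | _] =
    \bigcap_(i in [set: 'I_k]) ((@tnth _ (borel_dvr W))^~ i @^-1`
       [set x | f x = tnth s i])).
  apply: fin_bigcap_measurable => // i _; rewrite -[X in measurable X]setTI.
  by apply: measurable_tnth => //; apply: measurable_fiber.
apply/seteqP; split=> t /=; first by move=> <- i _ /=; rewrite tnth_map.
by move=> ts; apply: eq_from_tnth => i; rewrite tnth_map; apply: (ts i).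
Qed.

Lemma power_probability_fiber k (s : k.-tuple S) :
  power_probability mu k [set t | map_tuple f t = s] = (#|S|%:R^-1 ^+ k)%:E.
Proof.
elim: k s => [|k IHk] s.
  rewrite /= diracE mem_set //=.
  by rewrite (tuple0 s); apply: val_inj.
case/tupleP: s => a s.
rewrite /= /distribution /pushforward.
rewrite (_ : _ @^-1` _ = [set x | f x = a] `*` [set t | map_tuple f t = s]).
  rewrite product_measure1E; [|exact: measurable_fiber|
    exact: measurable_tuple_fiber].
  transitivity ((#|S|%:R^-1)%:E * (#|S|%:R^-1 ^+ k)%:E : \bar R)%E.
    by congr (_ * _)%E; [exact: haar_fiber | exact: IHk].
  by rewrite -EFinM -exprS.
apply/seteqP; split=> -[x t] /=.
  move=> /(congr1 (fun u : k.+1.-tuple S => u : seq S)) /= [xa ts].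
  by split=> //; apply: val_inj.
by move=> [xa ts]; apply: val_inj => /=; rewrite xa -ts.
Qed.

Definition map_pair d (ab : d.-tuple (borel_dvr W) * d.-tuple (borel_dvr W)) :
  d.-tuple S * d.-tuple S := (map_tuple f ab.1, map_tuple f ab.2).

Lemma map_pair_fiberE d (st : d.-tuple S * d.-tuple S) :
  [set ab | @map_pair d ab = st] =
  [set t | map_tuple f t = st.1] `*` [set t | map_tuple f t = st.2].
Proof.
apply/seteqP; split=> -[a b]; case: st => s t; first by case=> <- <-.
by move=> [/= sE tE]; rewrite /map_pair /= sE tE.
Qed.

Lemma measurable_map_pair_fiber d st :
  measurable [set ab | @map_pair d ab = st].
Proof.
by rewrite map_pair_fiberE; apply: measurableX; apply: measurable_tuple_fiber.
Qed.

Lemma measurable_map_pair d (E : {set d.-tuple S * d.-tuple S}) :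
  measurable [set ab | @map_pair d ab \in E].
Proof.
exact: (@measurable_preim_fin _ _ _ (@map_pair d)
  (@measurable_map_pair_fiber d) E).
Qed.

(** Reduction to the finite quotient carries the Haar measure to the uniform law, which turns
    probabilities into cardinalities. *)
Lemma haar_map_pair d (E : {set d.-tuple S * d.-tuple S}) :
  (power_probability mu d \x power_probability mu d)%E
    [set ab | map_pair ab \in E] = (#|E|%:R * (#|S|%:R^-1 ^+ (2 * d)))%:E.
Proof.
apply: measure_preim_fin; first exact: measurable_map_pair_fiber.
move=> st; rewrite map_pair_fiberE; apply: etrans.
  by apply: product_measure1E; apply: measurable_tuple_fiber.
transitivity ((#|S|%:R^-1 ^+ d)%:E * (#|S|%:R^-1 ^+ d)%:E : \bar R)%E.
  by congr (_ * _)%E; exact: power_probability_fiber.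
by rewrite -EFinM -exprD addnn mul2n.
Qed.

Lemma map_monic_of d (t : d.-tuple W) :
  map_poly f (monic_of t) = monic_of (map_tuple f t).
Proof.
rewrite /monic_of rmorphD /= map_polyXn; congr (_ + _).
apply/polyP => i; rewrite coef_map !coef_Poly /=.
have [it|ti] := ltnP i (size t); first by rewrite (nth_map 0).
by rewrite !nth_default ?size_map // rmorph0.
Qed.

Lemma map_subresultant d j (A B : {poly W}) :
  subresultant d j (map_poly f A) (map_poly f B) =
  map_poly f (subresultant d j A B).
Proof.
apply/polyP => k; rewrite coef_map !coef_poly; case: ltnP => [_|_].
  rewrite -[RHS](det_map_mx f); congr (\det _); apply/matrixP => r c.
  by rewrite !mxE -coef_map; case: ifP => _; rewrite rmorphM /= map_polyXn.
exact: esym (rmorph0 f).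
Qed.

End quotient.

Lemma card_tuple_family (S : finType) k (A : 'I_k -> {set S}) :
  #|[set t : k.-tuple S | [forall i, tnth t i \in A i]]%SET| =
  (\prod_i #|A i|)%N.
Proof.
pose phi (g : {ffun 'I_k -> S}) := [tuple g i | i < k].
have phiI : injective phi.
  move=> g h gh; apply/ffunP => i.
  by move/(congr1 (fun t => tnth t i)): gh; rewrite !tnth_mktuple.
transitivity #|(phi @: [set g | g \in family A])%SET|.
  apply: eq_card => t; rewrite inE; apply/forallP/imsetP.
    move=> tA; exists [ffun i => tnth t i].
      by rewrite inE; apply/familyP => i; rewrite ffunE.
    by apply: eq_from_tnth => i; rewrite tnth_mktuple ffunE.
  by move=> [g]; rewrite inE => /familyP gA -> i; rewrite tnth_mktuple.
rewrite card_imset // cardsE card_family foldrE big_map big_enum.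
by apply: eq_bigr => i _.
Qed.

(** The right side counts the remainders [Y] used in [haar2_level_set_ge]; the factor
    [(Q ^+ (w + m).+1) ^+ j.+1] on the left is the number of all remainders. *)
Lemma level_count (F : fieldType) (Q : F) j m w : Q != 0 ->
  (1 - Q^-1 ^+ j) * Q^-1 ^+ m * (Q^-1 ^+ j.+1) ^+ w *
    (Q ^+ (w + m).+1) ^+ j.+1 =
  (Q ^+ m.+1) ^+ j * Q - (Q ^+ m) ^+ j * Q.
Proof.
move=> Q0.
have e1 : (Q^-1 ^+ j.+1) ^+ w * (Q ^+ (w + m).+1) ^+ j.+1 = (Q ^+ m.+1) ^+ j.+1.
  rewrite -exprM (mulnC j.+1) exprM -exprMn -addnS exprVn exprD.
  by rewrite mulKf ?expf_neq0.
have e2 : Q^-1 ^+ m * (Q ^+ m.+1) ^+ j.+1 = Q * (Q ^+ m.+1) ^+ j.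
  rewrite [X in _ * X = _]exprS mulrA exprVn [in X in X * _]exprSr.
  by rewrite mulKf ?expf_neq0.
have e3 : Q^-1 ^+ j * (Q ^+ m.+1) ^+ j = (Q ^+ m) ^+ j.
  by rewrite -exprMn exprS mulKf.
by rewrite -mulrA e1 -mulrA e2 mulrBl mul1r mulrCA e3 !(mulrC Q).
Qed.

(** * Lifting from the residue field to finite quotients *)

Section lifting.
Variables (W : dvrType) (S S1 : finComNzRingType).
Variables (f : {rmorphism W -> S}) (f1 : {rmorphism W -> S1}) (n : nat).
Hypothesis f_eq : forall x y, f x = f y <-> maxideal_pow n.+1 (x - y).
Hypothesis f1_surj : forall s, exists x, f1 x = s.
Hypothesis f1_eq : forall x y, f1 x = f1 y <-> maxideal_pow 1 (x - y).

(* If [z := 1 - x * y] is in the maximal ideal, [x] divides [1 - z ^+ n.+1]. *)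
Lemma unit_lift x s : f1 x * s = 1 -> exists t, f x * t = 1.
Proof.
have [y <-] := f1_surj s; rewrite -rmorphM -(rmorph1 f1) => /f1_eq.
move=> /maxideal_powN/maxideal_powP[u]; rewrite opprB expr1 => uE.
pose z := 1 - x * y.
exists (f (y * \sum_(i < n.+1) z ^+ i)); rewrite -rmorphM -(rmorph1 f).
apply/f_eq; have -> : x * (y * \sum_(i < n.+1) z ^+ i) = 1 - z ^+ n.+1.
  by rewrite -{1}(expr1n _ n.+1) subrXX mulrA; congr (_ * _);
    [rewrite /z; ring | apply: eq_bigr => i _; rewrite expr1n mul1r].
rewrite addrC addKr; apply: maxideal_powN; apply/maxideal_powP.
by exists (u ^+ n.+1); rewrite /z uE exprMn.
Qed.

(** Primality of the maximal ideal makes [S1] a domain; in a finite domain, multiplication by [x] is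
    injective, hence bijective. *)
Lemma residue_invertible (x : S1) : x != 0 -> exists y, y * x = 1.
Proof.
have mulI : forall a b : S1, a * b = 0 -> a = 0 \/ b = 0.
  move=> a b; have [u <-] := f1_surj a; have [v <-] := f1_surj b.
  rewrite -rmorphM -(rmorph0 f1) => /f1_eq; rewrite subr0 => /maxideal_pow1.
  have [_ + _] := maxidealP W => /[apply] /orP[] /maxideal_pow1 H.
    by left; apply/f1_eq; rewrite subr0.
  by right; apply/f1_eq; rewrite subr0.
move=> x0; have xI : injective (fun y => y * x).
  move=> y z /eqP; rewrite -subr_eq0 -mulrBl => /eqP/mulI[/eqP|xE].
    by rewrite subr_eq0 => /eqP.
  by rewrite xE eqxx in x0.
by have [g _ gK] := injF_bij xI; exists (g 1); apply: gK.
Qed.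

(** Goodness is traded for invertibility of the principal subresultant, which commutes with
    reduction and lifts by [unit_lift], and then traded back. *)
Lemma euclid_good_lift d k
    (ab : d.-tuple (borel_dvr W) * d.-tuple (borel_dvr W)) : (k <= d)%N ->
  map_pair f1 ab \in euclid_good d [set: k.-tuple S1]%SET ->
  map_pair f ab \in euclid_good d [set: k.-tuple S]%SET.
Proof.
move=> kd /euclid_goodP[U [V [U' [V' [E _]]]]]; apply/euclid_goodP.
have [s] := euclid_at_principal_subresultant (monic_monic_of _)
  (size_monic_of _) (size_monic_of _) E.
rewrite /= -!map_monic_of /principal_subresultant map_subresultant coef_map /=.
move=> /unit_lift[t]; rewrite -[f _ * _]/(_ * _) -coef_map -map_subresultant.
rewrite !map_monic_of => Xt.
have [P [Q [P' [Q' F]]]] := principal_subresultant_euclid_at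
  (monic_monic_of _) (size_monic_of _) (monic_monic_of _) (size_monic_of _)
  kd Xt.
by exists P, Q, P', Q'; split => //; rewrite finset.in_setT.
Qed.

End lifting.

(** * The distribution of the valuations *)

Section level.
Variables (R : realType) (W : dvrType) (q : nat).
Hypothesis Wq : ([set: residue_field W] #= `I_q)%card.
Variable mu : probability (borel_dvr W) R.
Hypothesis mu_haar : is_haar mu.
Variables (d j m : nat).
Hypothesis j_lt_d : (j < d)%N.

Local Notation pairs := (d.-tuple (borel_dvr W) * d.-tuple (borel_dvr W))%type.
Local Notation haar2 := (power_probability mu d \x power_probability mu d)%E.

Definition sres (ab : pairs) (k : nat) : W :=
  (subresultant d j (@monic_of W d ab.1) (@monic_of W d ab.2))`_k.

Definition level_set w : set pairs := [set ab | delta_level j m w (sres ab)].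

Lemma map_sres (S : finComNzRingType) (f : {rmorphism W -> S}) (ab : pairs) k :
  f (sres ab k) = (subresultant d j (monic_of (map_pair f ab).1)
                     (monic_of (map_pair f ab).2))`_k.
Proof. by rewrite /map_pair /= -!map_monic_of map_subresultant coef_map. Qed.

(** By [delta_level_eqmod] the set is the full preimage of its image in the quotient of exponent
    [(w + m).+1]. *)
Lemma measurable_level_set w : measurable (level_set w).
Proof.
have [S [f [_ f_eq _ _]]] := ex_finite_quotient (w + m) Wq.
pose X := [set st | `[< exists2 ab : pairs, level_set w ab &
                         map_pair f ab = st >]]%SET.
rewrite (_ : level_set w = [set ab | map_pair f ab \in X]).
  exact (measurable_map_pair f_eq X).
apply/seteqP; split=> ab /=; rewrite finset.inE; last first.
  move=> /asboolP[ab' ab'w fE]; apply: delta_level_eqmod ab'w => k.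
  by apply/f_eq; rewrite !map_sres fE.
by move=> abw; apply/asboolP; exists ab.
Qed.

Lemma q_gt1 : (1 < q)%N.
Proof.
have [S [f [_ _ qS _]]] := ex_finite_quotient 0 Wq.
rewrite -[q]expn1 -qS; rewrite (cardD1 (0 : S)) (cardD1 (1 : S)) !inE.
by rewrite oner_eq0.
Qed.

Lemma haar2_euclid_good_ge (S : finComNzRingType) (f : {rmorphism W -> S}) n :
  (forall x y, f x = f y <-> maxideal_pow n.+1 (x - y)) ->
  ((1 - q%:R^-1)%:E <= haar2 [set ab |
     map_pair f ab \in euclid_good d [set: j.+1.-tuple S]%SET])%E.
Proof.
move=> f_eq; have [S1 [f1 [f1_surj f1_eq qS1 _]]] := ex_finite_quotient 0 Wq.
rewrite expn1 in qS1.
set G := euclid_good d [set: j.+1.-tuple S1]%SET.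
apply: (@le_trans _ _ (haar2 [set ab | map_pair f1 ab \in G])); last first.
  apply: le_measure; rewrite ?inE.
  - exact (measurable_map_pair f1_eq _).
  - exact (measurable_map_pair f_eq _).
  - by move=> ab; apply: euclid_good_lift f_eq f1_surj f1_eq _ _ _ _.
rewrite (haar_map_pair mu_haar f1_surj f1_eq) lee_fin qS1.
have q0 : 0 < q%:R :> R by rewrite ltr0n; have := q_gt1; lia.
have := card_not_euclid_good j_lt_d (residue_invertible f1_surj f1_eq).
rewrite -/G qS1 => bad.
have := cardsC G; rewrite card_prod !card_tuple qS1 -expnD addnn -mul2n => GC.
rewrite exprVn ler_pdivlMr ?exprn_gt0 // mulrBl mul1r.
have -> : #|G|%:R = q%:R ^+ (2 * d) - #|~: G|%:R :> R.
  by rewrite -natrX -GC natrD addrK.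
by rewrite lerD2l lerN2 ler_pdivlMl // -natrX -natrM ler_nat mulnC.
Qed.

(** The first factor bounds the probability of a good pair; the rest is the proportion of [Y] among
    all remainders, which equidistribution transfers to the good pairs. *)
Lemma haar2_level_set_ge w :
  (((1 - q%:R^-1) * ((1 - q%:R^-1 ^+ j) * q%:R^-1 ^+ m) *
     (q%:R^-1 ^+ j.+1) ^+ w)%:E <= haar2 (level_set w))%E.
Proof.
set N := (w + m)%N.
have [S [f [f_surj f_eq qS cardI]]] := ex_finite_quotient N Wq.
pose I i := [set s : S | `[< exists2 x, maxideal_pow i x & f x = s >]]%SET.
have IP i x : (i <= N.+1)%N -> f x \in I i -> maxideal_pow i x.
  move=> iN; rewrite finset.inE => /asboolP[y yi /esym/f_eq xy].
  by have := maxideal_powD (maxideal_powS_le iN xy) yi; rewrite subrK.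
have IM i v s : s \in I i -> v * s \in I i.
  rewrite !finset.inE => /asboolP[x xi <-]; apply/asboolP.
  have [y <-] := f_surj v; exists (y * x); last by rewrite rmorphM.
  exact: maxideal_powMl.
have IS i x : maxideal_pow i x -> f x \in I i.
  by move=> xi; rewrite finset.inE; apply/asboolP; exists x.
(* The last coordinate is constrained by [w + m] whatever [i] is, so [Y] below asks one of the first
   [j] coordinates to have valuation exactly [w]. For [m = 0] this omits tuples where only the last
   one attains [w], which a lower bound allows. *)
pose fam i (l : 'I_j.+1) := if (l < j)%N then I i else I (w + m)%N.
pose F i := [set t : j.+1.-tuple S | [forall l, tnth t l \in fam i l]]%SET.
have cardF i : (i <= N.+1)%N -> #|F i| = ((q ^ (N.+1 - i)) ^ j * q)%N.
  move=> iN; rewrite card_tuple_family big_ord_recr /= {2}/fam ltnn cardI //.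
  rewrite -/N subSnn expn1; congr (_ * _)%N.
  transitivity (\prod_(l < j) (q ^ (N.+1 - i)))%N.
    by apply: eq_bigr => l _; rewrite /fam /= ltn_ord cardI.
  by rewrite prod_nat_const card_ord.
pose Y := (F w :\: F w.+1)%SET.
have F_sub : F w.+1 \subset F w.
  apply/fintype.subsetP => t; rewrite !finset.inE => /forallP tF.
  apply/forallP => l; have := tF l; rewrite /fam; case: ifP => // _.
  rewrite !finset.inE => /asboolP[x xw <-]; apply/asboolP; exists x => //.
  exact: maxideal_powS_le xw.
have cardY : #|Y|%:R =
    (q%:R ^+ m.+1) ^+ j * q%:R - (q%:R ^+ m) ^+ j * q%:R :> R.
  rewrite cardsD (finset.setIidPr F_sub) natrB ?subset_leq_card //.
  rewrite !cardF //; [|rewrite /N; lia..].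
  have -> : (N.+1 - w = m.+1)%N by rewrite /N; lia.
  have -> : (N.+1 - w.+1 = m)%N by rewrite /N; lia.
  by rewrite !natrM !natrX.
(* The subresultant is [v] times the remainder, with inverse [y]: [v] carries the memberships from
   the remainder to the subresultant, and [y] carries them back. *)
have good_level ab : map_pair f ab \in euclid_good d Y -> level_set w ab.
  move=> /euclid_goodP[U [V [U' [V' [E]]]]]; rewrite finset.inE => /andP[nY].
  rewrite finset.inE => /forallP YF.
  have [v [y [vy resE]]] := euclid_at_subresultant (monic_monic_of _)
    (size_monic_of _) (size_monic_of _) E.
  have fE k : f (sres ab k) = v * (euclid_rem (map_pair f ab) U' V')`_k.
    by rewrite map_sres resE coefZ.
  have fE' k : (euclid_rem (map_pair f ab) U' V')`_k = y * f (sres ab k).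
    by rewrite fE mulrA (mulrC y) vy mul1r.
  have resF (l : 'I_j.+1) : f (sres ab l) \in fam w l.
    have := YF l; rewrite tnth_mktuple fE /fam.
    by case: ifP => _; apply: IM.
  have cj : maxideal_pow (w + m) (sres ab j).
    by have := resF ord_max; rewrite /fam /= ltnn; apply: IP.
  split=> //.
    move=> k; rewrite leq_eqVlt => /predU1P[->|kj].
      by apply: maxideal_powS_le cj; lia.
    have := resF (Ordinal (ltnW kj : k < j.+1)%N).
    by rewrite /fam /= kj; apply: IP; rewrite /N; lia.
  apply: contrapT => all_w; case/negP: nY; rewrite finset.inE.
  apply/forallP => l.
  rewrite tnth_mktuple fE' /fam; case: ifP => lj; last first.
    apply: IM; apply: IS; have -> // : l = j :> nat.
    by apply/eqP; rewrite eqn_leq -ltnS ltn_ord /= leqNgt lj.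
  apply: IM; apply: IS; apply: contrapT => nw; apply: all_w.
  by exists l => //; rewrite -ltnS.
have q0 : 0 < q%:R :> R by rewrite ltr0n; have := q_gt1; lia.
have qn0 : q%:R != 0 :> R by rewrite gt_eqF.
apply: (@le_trans _ _ (haar2 [set ab | map_pair f ab \in euclid_good d Y]));
    last first.
  apply: le_measure; last exact: good_level.
    apply: mem_set; exact (measurable_map_pair f_eq _).
  by apply: mem_set; apply: measurable_level_set.
have := haar2_euclid_good_ge f_eq.
rewrite !(haar_map_pair mu_haar f_surj f_eq) !lee_fin => G_ge.
have := card_euclid_good d Y; rewrite -(ler_nat R) !natrM natrX.
set G := euclid_good d [set: j.+1.-tuple S]%SET in G_ge *.
set GY := euclid_good d Y; set c := #|S|%:R^-1 ^+ (2 * d) in G_ge *.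
move=> G_le; have c0 : 0 <= c by rewrite exprn_ge0 // invr_ge0.
have Sn0 : 0 < #|S|%:R ^+ j.+1 :> R by rewrite exprn_gt0 // qS natrX exprn_gt0.
(* Once multiplied by the number of remainders, the left side equals [(1 - q^-1) * #|Y|] by
   [level_count]; [G_ge] and then [G_le] bound it. *)
rewrite -(ler_pM2r Sn0).
apply: (@le_trans _ _ (#|G|%:R * c * #|Y|%:R)); last first.
  by rewrite -mulrA (mulrC c) mulrA -(mulrA _ c) (mulrC c) mulrA ler_wpM2r.
apply: (@le_trans _ _ ((1 - q%:R^-1) * #|Y|%:R)); last first.
  by rewrite ler_wpM2r.
rewrite le_eqVlt; apply/orP; left; apply/eqP.
by rewrite cardY qS natrX -(level_count j m w qn0) !mulrA.
Qed.

Lemma measurable_delta :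
  measurable [set ab : pairs | exists w, level_set w ab].
Proof.
rewrite (_ : [set ab | _] = \bigcup_w level_set w).
  by apply: bigcup_measurable => w _; apply: measurable_level_set.
by apply/seteqP; split=> ab [w]; [exists w | move=> _; exists w].
Qed.

(** The level sets are disjoint, so their lower bounds add up to a geometric series of ratio [r];
    finite unions bound the partial sums, and the limit follows. *)
Lemma haar2_delta_ge :
  ((((q%:R - 1) * (q%:R ^+ j - 1)) / (q%:R ^+ j.+1 - 1) * q%:R ^- m)%:E <=
   haar2 [set ab : pairs | exists w, level_set w ab])%E.
Proof.
have q1 : 1 < q%:R :> R by rewrite ltr1n q_gt1.
have q0 : 0 < q%:R :> R by apply: lt_trans q1.
set p := haar2 _; have p_fin : p \is a fin_num.
  have := @fin_num_measure _ _ _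
    ((power_probability mu d \x power_probability mu d)%E :
     probability pairs R).
  by move=> /(_ _ measurable_delta).
pose a : R := (1 - q%:R^-1) * ((1 - q%:R^-1 ^+ j) * q%:R^-1 ^+ m).
pose r : R := q%:R^-1 ^+ j.+1.
have r0 : 0 < r by rewrite exprn_gt0 // invr_gt0.
have r1 : r < 1 by rewrite exprn_ilt1 // ?invr_ge0 ?ltW // invf_lt1.
have a0 : 0 <= a.
  have V1 : q%:R^-1 <= 1 :> R by rewrite invf_le1 // ltW.
  have V0 : 0 <= q%:R^-1 :> R by rewrite invr_ge0 ltW.
  by rewrite !mulr_ge0 ?subr_ge0 ?exprn_ge0 // exprn_ile1.
have sum_le K : \sum_(w < K) a * r ^+ w <= fine p.
  rewrite -lee_fin fineK // -sumEFin.
  apply: (@le_trans _ _ (\sum_(w < K) haar2 (level_set w))%E).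
    by apply: lee_sum => w _; apply: haar2_level_set_ge.
  rewrite -measure_bigsetU; last 2 first.
  - by move=> w; apply: measurable_level_set.
  - by apply/trivIsetP => u v _ _ uv; apply/seteqP; split=> // ab [/= abu abv];
      case/eqP: uv; apply: delta_level_fun abu abv.
  apply: le_measure.
  - apply: mem_set; apply: bigsetU_measurable => w _.
    exact: measurable_level_set.
  - by apply: mem_set; apply: measurable_delta.
  - by move=> ab; rewrite -bigcup_mkord => -[w _ abw]; exists w.
have geom_le K : a / (1 - r) - a / (1 - r) * r ^+ K <= fine p.
  apply: le_trans (sum_le K); rewrite -mulr_sumr -[X in _ - X]mulrA -mulrBr.
  have -> : \sum_(w < K) r ^+ w = (1 - r ^+ K) / (1 - r).
    rewrite -{1}(expr1n _ K) subrXX mulrAC divff ?mul1r; last first.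
      by rewrite subr_eq0 gt_eqF.
    by apply: eq_bigr => i _; rewrite expr1n mul1r.
  rewrite le_eqVlt; apply/orP; left; apply/eqP.
  by field; rewrite subr_eq0 gt_eqF.
have lim_le : a / (1 - r) <= fine p.
  have cv : (a / (1 - r) - a / (1 - r) * r ^+ K) @[K --> \oo] -->
      (a / (1 - r) - a / (1 - r) * 0).
    have cr : r ^+ K @[K --> \oo] --> (0 : R).
      by apply: cvg_expr; rewrite ger0_norm // ltW.
    exact: cvgB (cvg_cst _) (cvgM (cvg_cst _) cr).
  rewrite mulr0 subr0 in cv.
  by apply: (cvgr_to_le cv); near=> K; apply: geom_le.
rewrite -(fineK p_fin) lee_fin; apply: le_trans lim_le.
(* Multiplying numerator and denominator of [a / (1 - r)] by [q ^ j.+1] gives the stated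
   constant. *)
rewrite le_eqVlt; apply/orP; left; apply/eqP; rewrite /a /r !exprVn exprS.
have qj1 : q%:R * q%:R ^+ j - 1 != 0 :> R.
  by rewrite subr_eq0 gt_eqF // -exprS exprn_egt1.
by field; rewrite qj1 !expf_neq0 ?gt_eqF.
Unshelve. all: end_near. Qed.

End level.

Unset Implicit Arguments.
Set Strict Implicit.
Set Printing Implicit Defensive.

Theorem theorem3p5 (R : realType) (W : dvrType) (q : nat)
    (Wcomplete : adic_complete W)
    (Wq : ([set: residue_field W] #= `I_q)%card)
    (mu : probability (borel_dvr W) R) (mu_haar : is_haar mu)
    (d : nat) (d_ge1 : (1 <= d)%N)
    (disp : measure_display) (Omega : measurableType disp)
    (P : probability Omega R)
    (AB : {RV P >-> (d.-tuple (borel_dvr W) * d.-tuple (borel_dvr W))%type})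
    (AB_haar : forall E, measurable E ->
      distribution P AB E =
        (power_probability mu d \x power_probability mu d)%E E)
    (j m : nat) (j_lt_d : (j < d)%N) :
  ((((q%:R - 1) * (q%:R ^+ j - 1)) / (q%:R ^+ j.+1 - 1) * q%:R ^- m)%:E <=
   P [set w | (m%:R%:E <=
      subresultant_delta R d j
        (@monic_of W d (AB w).1) (@monic_of W d (AB w).2))%E])%E.
Proof.
set E := [set w | _].
(* [delta_levelP], applied to the coefficients of the subresultant, identifies the event with the
   preimage under [AB] of the union of the level sets. *)
have -> : P E = distribution P AB [set ab | exists w, level_set j m w ab].
  congr (P _); apply/seteqP; split=> w.
    exact: (delta_levelP R j m (sres j (AB w))).1.
  exact: (delta_levelP R j m (sres j (AB w))).2.
rewrite AB_haar; last exact (@measurable_delta W q Wq d j m).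
exact: haar2_delta_ge.
Qed.
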